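(* Let $K$ be a quadratic field with embeddings into $\mathbb{R}$ and $\mathbb{Q}_2$, and let $\alpha\in K\setminus\mathbb{Q}$. With $p'_n,q'_n$ as defined in the context, there exist $\gamma,C,C'\in\mathbb{R}_{>0}$ with $0<\gamma<1$ such that for all $n\in\mathbb{Z}_{>0}$, $$\left|\alpha_\infty-\frac{p'_n}{q'_n}\right|\le\frac{C}{|q'_n|^{2-2\gamma}}\quad\text{and}\quad\left|\alpha_{\langle 2\rangle}-\frac{p'_n}{q'_n}\right|_2\le\frac{C'}{|q'_n|^{2\gamma}}.$$
   Context: $K$ is a quadratic field with fixed field embeddings $\sigma_\infty:K\to\mathbb{R}$ and $\sigma_2:K\to\mathbb{Q}_2$. For $\alpha\in K$ write $\alpha_\infty=\sigma_\infty(\alpha)$, $\alpha_{\langle 2\rangle}=\sigma_2(\alpha)$. $v_2$ is the $2$-adic valuation ($v_2(0)=+\infty$) and $|u|_2=2^{-v_2(u)}$; $|\cdot|$ is the real absolute value. For $u=\sum_{n}c_n2^n\in\mathbb{Q}_2$ with digits $c_n\in\{0,1\}$ ($c_n=0$ for $n<v_2(u)$), put $\lfloor u\rfloor_2=\sum_{n\le 0}c_n2^n\in\mathbb{Z}[1/2]$. For $\alpha\in K$ let $b^{(0)}(\alpha)=2m+\lfloor\alpha_{\langle 2\rangle}\rfloor_2$, where $m$ is the smallest among the integers $i$ minimizing $|\alpha_\infty-2i-\lfloor\alpha_{\langle 2\rangle}\rfloor_2|$; let $b^{(1)}(\alpha)=m'+\lfloor\alpha_{\langle 2\rangle}\rfloor_2$,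 where $m'$ is the smallest among the integers $i$ minimizing $|\alpha_\infty-i-\lfloor\alpha_{\langle 2\rangle}\rfloor_2|$. For $\epsilon\in\{0,1\}$ let $F_{2,\epsilon}(\alpha)=\frac{1}{\alpha-b^{(\epsilon)}(\alpha)}$. Algorithm: $\alpha_0=\alpha$; for $n\ge0$ put $\epsilon=0$ if $n$ is even and $\epsilon=1$ if $n$ is odd, $b_n(\alpha)=b^{(\epsilon)}(\alpha_n)$ and $\alpha_{n+1}=F_{2,\epsilon}(\alpha_n)$ (for $\alpha\in K\setminus\mathbb{Q}$ the algorithm never halts). Convergents: $p_{-1}=1$, $q_{-1}=0$ and, for $n\ge0$, $$\begin{pmatrix} p_n & p_{n-1} \\ q_n & q_{n-1} \end{pmatrix}=\begin{pmatrix} b_0(\alpha) & 1 \\ 1 & 0 \end{pmatrix}\cdots\begin{pmatrix} b_n(\alpha) & 1 \\ 1 & 0 \end{pmatrix};$$ $q_n\ne0$ for $n\ge0$. Put $s_0=1$ if $v_2(b_0(\alpha))>0$ and $s_0=0$ if $v_2(b_0(\alpha))\le0$, and $p'_n=2^{-\sum_{s=s_0}^n v_2(b_s(\alpha))}p_n$, $q'_n=2^{-\sum_{s=s_0}^n v_2(b_s(\alpha))}q_n$; these are coprime integers with $p'_n/q'_n=p_n/q_n$. *)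

(* Defs.v *)
From HB Require Import structures.
From mathcomp Require Import all_boot all_order all_algebra all_field.
From mathcomp Require Import generic_quotient ring_quotient.
From mathcomp Require Import all_classical all_reals all_analysis.
From mathcomp Require Import zify ring.

Set Implicit Arguments.
Unset Strict Implicit.
Unset Printing Implicit Defensive.

Import Order.TTheory GRing.Theory Num.Theory.
Local Open Scope ring_scope.

Definition v2rat (x : rat) : \bar int :=
  if x == 0 then +oo%E
  else ((logn 2 `|numq x|%N)%:Z - (logn 2 `|denq x|%N)%:Z)%:E.

Lemma v2rat0 : v2rat 0 = +oo%E.
Proof. by rewrite /v2rat eqxx. Qed.

Lemma v2ratN0 x : x != 0 -> v2rat x = (fine (v2rat x))%:E.
Proof. by rewrite /v2rat => /negPf ->. Qed.

Lemma v2rat_frac (a b : int) : a != 0 -> b != 0 ->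
  v2rat (a%:~R / b%:~R) = ((logn 2 `|a|%N)%:Z - (logn 2 `|b|%N)%:Z)%:E.
Proof.
move=> a0 b0; set x : rat := _ / _.
have x0 : x != 0 by rewrite mulf_neq0 ?invr_neq0 ?intr_eq0.
rewrite /v2rat (negPf x0); congr (_%:E).
have e : numq x * b = a * denq x.
  apply: (@intr_inj rat); rewrite !intrM numqE /x.
  by rewrite mulrAC divfK ?intr_eq0.
have := congr1 (fun z => logn 2 `|z|%N) e.
rewrite !abszM !lognM ?absz_gt0 ?numq_eq0 ?denq_neq0 //; lia.
Qed.

Lemma v2ratM x y : v2rat (x * y) = (v2rat x + v2rat y)%E.
Proof.
have [->|x0] := eqVneq x 0; first by rewrite mul0r v2rat0 /v2rat; case: ifP.
have [->|y0] := eqVneq y 0.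
  by rewrite mulr0 v2rat0 /v2rat; case: ifP.
rewrite -{1}[x]divq_num_den -{1}[y]divq_num_den mulf_div -!intrM.
rewrite v2rat_frac ?mulf_neq0 ?numq_eq0 ?denq_neq0 //.
rewrite /v2rat (negPf x0) (negPf y0) -EFinD; congr (_%:E).
rewrite !abszM !lognM ?absz_gt0 ?numq_eq0 ?denq_neq0 //; lia.
Qed.

Lemma v2ratN x : v2rat (- x) = v2rat x.
Proof. by rewrite /v2rat oppr_eq0 numqN denqN abszN. Qed.

Lemma logn2_addz (m : nat) (a b : int) : a + b != 0 ->
  (a != 0 -> (m <= logn 2 `|a|)%N) -> (b != 0 -> (m <= logn 2 `|b|)%N) ->
  (m <= logn 2 `|(a + b)%R|)%N.
Proof.
move=> ab0 ha hb.
have dv z : (z != 0 -> (m <= logn 2 `|z|)%N) -> ((2 ^ m)%N %| z)%Z.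
  have [->|z0] := eqVneq z 0; first by rewrite dvdz0.
  by move=> /(_ isT); rewrite dvdzE /= pfactor_dvdn ?absz_gt0.
rewrite -pfactor_dvdn ?absz_gt0 //.
exact: (rpredD (dv _ ha) (dv _ hb)).
Qed.

Lemma v2ratD (k : \bar int) x y :
  (k <= v2rat x)%E -> (k <= v2rat y)%E -> (k <= v2rat (x + y))%E.
Proof.
have [->|x0] := eqVneq x 0; first by rewrite add0r.
have [->|y0] := eqVneq y 0; first by rewrite addr0.
have [->|xy0] := eqVneq (x + y) 0; first by rewrite v2rat0 leey.
case: k => [k| |]; last 2 first.
- by rewrite v2ratN0.
- by rewrite !leNye.
have exy : x + y = (numq x * denq y + numq y * denq x)%:~R
    / (denq x * denq y)%:~R.
  rewrite -{1}[x]divq_num_den -{1}[y]divq_num_den addf_div ?intr_eq0 ?denq_neq0 //.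
  by rewrite intrD !intrM.
have n0 : numq x * denq y + numq y * denq x != 0.
  by apply: contraNneq xy0 => e; rewrite exy e mul0r.
rewrite exy v2rat_frac ?mulf_neq0 ?denq_neq0 // /v2rat (negPf x0) (negPf y0).
rewrite !lee_fin abszM lognM ?absz_gt0 ?denq_neq0 // => hx hy.
set d := (logn 2 `|denq x| + logn 2 `|denq y|)%N.
have [kd|kd] := leP (k + d%:Z) 0; first by lia.
have [m em] : exists m : nat, k + d%:Z = m%:Z.
  by exists `|(k + d%:Z)%R|%N; lia.
suff : (m <= logn 2 `|(numq x * denq y + numq y * denq x)%R|)%N by lia.
apply: logn2_addz => // _;
  rewrite abszM lognM ?absz_gt0 ?numq_eq0 ?denq_neq0 //; lia.
Qed.

(* [Q2] is built below as the completion of [rat] for the 2-adic absolute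
   value: Cauchy sequences modulo null sequences. *)

Definition cauchy2 (x : nat -> rat) : Prop := forall k : int, exists N : nat,
  forall m n, (N <= m)%N -> (N <= n)%N -> (k%:E <= v2rat (x m - x n)%R)%E.

Definition null2 (x : nat -> rat) : Prop := forall k : int, exists N : nat,
  forall n, (N <= n)%N -> (k%:E <= v2rat (x n))%E.

Definition cauchy2b : {pred nat -> rat} := fun x => `[< cauchy2 x >].

Lemma cauchy2_bounded x : cauchy2 x ->
  exists k : int, forall n, (k%:E <= v2rat (x n))%E.
Proof.
move=> /(_ 0) [N hN].
have bd M : exists k : int, forall n, (n < M)%N -> (k%:E <= v2rat (x n))%E.
  elim: M => [|M [k hk]]; first by exists 0.
  have [xM0|xM0] := eqVneq (x M) 0.
    exists k => n; rewrite ltnS leq_eqVlt => /orP[/eqP ->|/hk //].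
    by rewrite xM0 v2rat0 leey.
  exists (Num.min k (fine (v2rat (x M)))) => n.
  rewrite ltnS leq_eqVlt => /orP[/eqP ->|/hk].
    by rewrite {2}v2ratN0 // lee_fin ge_min lexx orbT.
  by apply: le_trans; rewrite lee_fin ge_min lexx.
have [k hk] := bd N.+1.
exists (Num.min k 0) => n.
have [nN|Nn] := ltnP n N.
  by apply: le_trans (hk n (ltnW nN)); rewrite lee_fin ge_min lexx.
rewrite -[x n](subrK (x N)); apply: v2ratD.
  by apply: le_trans (hN n N Nn (leqnn _)); rewrite lee_fin ge_min lexx orbT.
by apply: le_trans (hk N (leqnn _)); rewrite lee_fin ge_min lexx.
Qed.

Lemma v2ratM_ge (j k : int) x y : (j%:E <= v2rat x)%E -> (k%:E <= v2rat y)%E ->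
  ((j + k)%:E <= v2rat (x * y)%R)%E.
Proof. by move=> hx hy; rewrite v2ratM EFinD leeD. Qed.

Lemma cauchy2b_subring : subring_closed cauchy2b.
Proof.
split.
- apply/asboolP => k; exists 0%N => m n _ _.
  by rewrite /= subrr v2rat0 leey.
- move=> x y /asboolP hx /asboolP hy; apply/asboolP => k.
  have [Nx {}hx] := hx k; have [Ny {}hy] := hy k.
  exists (maxn Nx Ny) => m n; rewrite !geq_max => /andP[xm ym] /andP[xn yn].
  rewrite (_ : _ - _ = (x m - x n) + - (y m - y n)).
    by apply: v2ratD; rewrite ?v2ratN; [exact: hx|exact: hy].
  by rewrite !fctE; ring.
- move=> x y /asboolP hx /asboolP hy; apply/asboolP => k.
  have [bx hbx] := cauchy2_bounded hx; have [b_ hby] := cauchy2_bounded hy.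
  have [Nx {}hx] := hx (k - b_); have [Ny {}hy] := hy (k - bx).
  exists (maxn Nx Ny) => m n; rewrite !geq_max => /andP[xm ym] /andP[xn yn].
  have -> : (x * y) m - (x * y) n = (x m - x n) * y m + x n * (y m - y n).
    by rewrite !fctE; ring.
  apply: v2ratD.
    by rewrite -[k](subrK b_); apply: v2ratM_ge; [exact: hx|exact: hby].
  rewrite -[k](subrK bx) addrC.
  by apply: v2ratM_ge; [exact: hbx|exact: hy].
Qed.

HB.instance Definition _ :=
  GRing.isSubringClosed.Build (nat -> rat) cauchy2b cauchy2b_subring.

Record cauchySeq2 := CauchySeq2 {
  cauchy_seq :> nat -> rat; _ : cauchy_seq \in cauchy2b }.

HB.instance Definition _ := [isSub for cauchy_seq].
HB.instance Definition _ := [Choice of cauchySeq2 by <:].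
HB.instance Definition _ :=
  [SubChoice_isSubComNzRing of cauchySeq2 by <:].

Definition null2b : {pred cauchySeq2} := fun x => `[< null2 x >].

Lemma null2b_ideal : idealr_closed null2b.
Proof.
split.
- by apply/asboolP => k; exists 0%N => n _; rewrite v2rat0 leey.
- apply/negP => /asboolP /(_ 1) [N /(_ N (leqnn _))].
  by rewrite /v2rat /= lee_fin.
- move=> a x y /asboolP hx /asboolP hy; apply/asboolP => k.
  have [b hb] := cauchy2_bounded (asboolW (valP a)).
  have [Nx {}hx] := hx (k - b); have [Ny {}hy] := hy k.
  exists (maxn Nx Ny) => n; rewrite !geq_max => /andP[xn yn].
  apply: v2ratD; last exact: hy.
  by rewrite -[k](subrK b) addrC; apply: v2ratM_ge; [exact: hb|exact: hx].
Qed.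

HB.instance Definition _ := isIdealr.Build cauchySeq2 null2b null2b_ideal.

Definition Q2 : Type := {ideal_quot null2b}.
HB.instance Definition _ := GRing.ComNzRing.on Q2.
Local Open Scope quotient_scope.

Definition to_Q2 : cauchySeq2 -> Q2 := \pi_{ideal_quot null2b}.
HB.instance Definition _ := GRing.RMorphism.on to_Q2.

Lemma to_Q2_eq0 (x : cauchySeq2) : (to_Q2 x == 0) = (x \in null2b).
Proof.
by rewrite -[in RHS](subr0 x) Quotient.idealrBE -(rmorph0 to_Q2).
Qed.

Lemma to_Q2_repr (u : Q2) : to_Q2 (repr (u : {ideal_quot null2b})) = u.
Proof. exact: reprK. Qed.

Lemma v2ratV (x : rat) : x != 0 -> v2rat x^-1 = (- v2rat x)%E.
Proof.
move=> x0; have := v2ratM x x^-1; rewrite divff //.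
rewrite [v2rat x]v2ratN0 // [v2rat x^-1]v2ratN0 ?invr_eq0 //.
by rewrite /v2rat /= => -[e]; congr (_%:E); lia.
Qed.

Lemma v2ratD_lt (x d : rat) : (v2rat x < v2rat d)%E -> v2rat (x + d) = v2rat x.
Proof.
move=> xd; have h : (v2rat x <= v2rat (x + d))%E by rewrite v2ratD // ltW.
apply/eqP; rewrite eq_le h andbT leNgt; apply/negP => lt.
have : (Order.min (v2rat d) (v2rat (x + d)) <= v2rat x)%E.
  rewrite -{2}(addrK d x); apply: v2ratD; first by rewrite ge_min lexx orbT.
  by rewrite v2ratN ge_min lexx.
by rewrite leNgt lt_min xd lt.
Qed.

Lemma cauchy2_stable (x : nat -> rat) : cauchy2 x -> ~ null2 x ->
  exists (N : nat) (v : int), forall n, (N <= n)%N -> v2rat (x n) = v%:E.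
Proof.
move=> hx /existsNP [k] /forallNP hk.
have [N {}hx] := hx k.
have /existsNP [n0 /not_implyP [Nn0 /negP]] := hk N.
rewrite -ltNge => lt.
have x0 : x n0 != 0 by apply: contraTneq lt => ->; rewrite v2rat0 ltNge leey.
exists N, (fine (v2rat (x n0))) => n Nn; rewrite -v2ratN0 //.
rewrite -[x n](subrKC (x n0)) v2ratD_lt //.
exact: lt_le_trans lt (hx _ _ _ _).
Qed.

Lemma Q2_inv_ex (u : Q2) : u != 0 -> exists v : Q2, v * u = 1.
Proof.
rewrite -[u]to_Q2_repr; move: (repr _) => x; rewrite to_Q2_eq0 => nx.
have cx : cauchy2 x by exact: asboolW (valP x).
have [|N [v hv]] := cauchy2_stable cx; first by move=> h; case/asboolP: nx.
have x0 n : (N <= n)%N -> x n != 0.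
  by move=> /hv e; apply/eqP => e0; move: e; rewrite e0 v2rat0.
have cy : (fun n => (x n)^-1) \in cauchy2b.
  apply/asboolP => k; have [N' hN'] := cx (k + v + v).
  exists (maxn N N') => m n; rewrite !geq_max => /andP[Nm N'm] /andP[Nn N'n].
  have -> : (x m)^-1 - (x n)^-1 = (x n - x m) * ((x m)^-1 * (x n)^-1).
    by field; rewrite !x0.
  have -> : k = (k + v + v) + (- v + - v) by ring.
  apply: v2ratM_ge; first exact: hN'.
  by apply: v2ratM_ge; rewrite v2ratV ?x0 // hv.
exists (to_Q2 (CauchySeq2 cy)); apply/eqP; rewrite -subr_eq0.
rewrite -(rmorph1 to_Q2) -rmorphM -rmorphB to_Q2_eq0; apply/asboolP => k.
exists N => n Nn.
have -> : (CauchySeq2 cy * x - 1 : cauchySeq2) n = (x n)^-1 * x n - 1 by [].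
by rewrite mulVf ?x0 // subrr v2rat0 leey.
Qed.

Local Open Scope classical_set_scope.

Definition Q2_inv (u : Q2) : Q2 := xget 0 [set v : Q2 | v * u = 1].

Lemma Q2_mulVf (u : Q2) : u != 0 -> Q2_inv u * u = 1.
Proof. by move=> /Q2_inv_ex; apply: (@xgetPex _ 0 [set v : Q2 | v * u = 1]). Qed.

Lemma Q2_inv0 : Q2_inv 0 = 0.
Proof.
by rewrite /Q2_inv xgetPN // => v; rewrite /= mulr0 => /esym/eqP; rewrite oner_eq0.
Qed.

HB.instance Definition _ := GRing.ComNzRing_isField.Build Q2 Q2_mulVf Q2_inv0.

(* The 2-adic valuation is eventually constant along a Cauchy sequence that is
   not null; for null sequences the value is [+oo]. *)
Definition v2 (u : Q2) : \bar int :=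
  xget +oo%E [set v : \bar int | exists N : nat, forall n, (N <= n)%N ->
    v2rat ((repr (u : {ideal_quot null2b}) : cauchySeq2) n) = v].

Lemma v2_to_Q2 (x : cauchySeq2) (v : \bar int) (N : nat) :
  (forall n, (N <= n)%N -> v2rat (x n) = v) -> v2 (to_Q2 x) = v.
Proof.
move=> hx; rewrite /v2; set r := repr _.
have /asboolP nr : null2b (r - x).
  by rewrite [null2b _](_ : _ = (r - x \in null2b)) // Quotient.idealrBE reprK.
have eqr n : r n = x n + (r - x : cauchySeq2) n.
  by rewrite -[LHS]/((r : nat -> rat) n) /= !fctE; ring.
case: v hx => [v| |] hx.
- have [M hM] := nr (v + 1).
  have hr n : (maxn N M <= n)%N -> v2rat (r n) = v%:E.
    rewrite geq_max => /andP[Nn Mn]; rewrite eqr v2ratD_lt hx //.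
    by apply: lt_le_trans (hM n Mn); rewrite lte_fin ltrDl.
  case: xgetP => [w _ [M' hw]|/(_ v%:E) []]; last by exists (maxn N M).
  by rewrite -(hw (maxn M' (maxn N M))) ?hr // leq_max leqnn ?orbT.
- case: xgetP => // w _ [M hw].
  have wge (k : int) : (k%:E <= w)%E.
    have [M' hM'] := nr k; pose n := maxn N (maxn M M').
    rewrite -(hw n) ?eqr; last by rewrite !leq_max leqnn orbT.
    apply: v2ratD; first by rewrite hx ?leey // leq_max leqnn.
    by apply: hM'; rewrite !leq_max leqnn !orbT.
  case: w {hw} wge => [w /(_ (w + 1))| |/(_ 0)] //.
  by rewrite lee_fin gerDl ler10.
- by have := hx N (leqnn _); rewrite /v2rat; case: ifP.
Qed.

Lemma const_cauchy2 (r : rat) : (fun=> r) \in cauchy2b.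
Proof.
by apply/asboolP => k; exists 0%N => m n _ _; rewrite subrr v2rat0 leey.
Qed.

Lemma ratr_Q2 (r : rat) : ratr r = to_Q2 (CauchySeq2 (const_cauchy2 r)).
Proof.
pose f (r : rat) := to_Q2 (CauchySeq2 (const_cauchy2 r)).
have fB : zmod_morphism f.
  by move=> x y; rewrite /f -rmorphB; congr to_Q2; apply: val_inj; apply/funext.
have fM : monoid_morphism f.
  split; first by rewrite -(rmorph1 to_Q2); congr to_Q2; apply: val_inj.
  by move=> x y; rewrite /f -rmorphM; congr to_Q2; apply: val_inj; apply/funext.
pose fA := GRing.isZmodMorphism.Build rat Q2 f fB.
pose fR := GRing.isMonoidMorphism.Build rat Q2 f fM.
pose F : {rmorphism rat -> Q2} := HB.pack f fA fR.
by rewrite -[RHS]/(F r) fmorph_eq_rat.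
Qed.

Lemma v2_ratr (r : rat) : v2 (ratr r) = v2rat r.
Proof. by rewrite ratr_Q2 (@v2_to_Q2 _ (v2rat r) 0). Qed.

Definition abs2 (R : realType) (u : Q2) : R :=
  if v2 u is k%:E then 2 ^ (- k) else 0.

(* [c] is the digit sequence of [u]: [u] is the 2-adic sum of the
   [c n * 2 ^ n], and [c n = 0] for [n < v_2(u)]. *)
Definition is_digits2 (u : Q2) (c : int -> bool) : Prop :=
  (forall n : int, (n%:E < v2 u)%E -> c n = false) /\
  (forall M : int, (M%:E <= v2 u)%E ->
   forall A : int, exists k0 : nat, forall k : nat, (k0 <= k)%N ->
     (A%:E <= v2 (u - ratr (\sum_(i < k) (c (M + i%:Z))%:R * 2 ^ (M + i%:Z)))%R)%E).

Definition digits2 (u : Q2) : int -> bool :=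
  xget (fun=> false) [set c | is_digits2 u c].

(* The sum over all [n <= 0] of [c n * 2 ^ n], with [n = - i]; the digits
   beyond [i = |v_2(u)|] vanish. *)
Definition floor2 (u : Q2) : rat :=
  \sum_(i < `|fine (v2 u)|%N.+1) (digits2 u (- i%:Z))%:R * 2 ^ (- i%:Z).

Definition is_argmin (R : realType) (f : int -> R) (m : int) : Prop :=
  forall i : int, f m <= f i.

Definition least_argmin (R : realType) (f : int -> R) : int :=
  xget 0 [set m : int | is_argmin f m /\
                        forall i : int, is_argmin f i -> m <= i].

Section Algorithm.
Variables (R : realType) (K : fieldExtType rat).
Variables (soo : {rmorphism K -> R}) (s2 : {rmorphism K -> Q2}).

(* b^(0) and b^(1); the superscript is [false] for 0 and [true] for 1 *)
Definition b_eps (eps : bool) (a : K) : rat :=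
  let fl := floor2 (s2 a) in
  if eps then
    (least_argmin (fun i => `|soo a - i%:~R - ratr fl|))%:~R + fl
  else
    2 * (least_argmin (fun i => `|soo a - 2 * i%:~R - ratr fl|))%:~R + fl.

Definition F2 (eps : bool) (a : K) : K := 1 / (a - ratr (b_eps eps a)).

Fixpoint alpha_ (a : K) (n : nat) : K :=
  if n is k.+1 then F2 (odd k) (alpha_ a k) else a.

Definition b_ (a : K) (n : nat) : rat := b_eps (odd n) (alpha_ a n).

Definition cf_mx (b : rat) : 'M[rat]_2 :=
  \matrix_(i, j) if i == 0 then (if j == 0 then b else 1) else (j == 0)%:R.

Definition conv_mx (a : K) (n : nat) : 'M[rat]_2 :=
  \prod_(0 <= k < n.+1) cf_mx (b_ a k).

Definition p_ (a : K) (n : nat) : rat := conv_mx a n 0 0.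
Definition q_ (a : K) (n : nat) : rat := conv_mx a n 1 0.

Definition s0 (a : K) : nat := if (0 < v2rat (b_ a 0))%E then 1 else 0.

(* [fine] is harmless: [b_ a s] can only vanish for [s = 0], in which case the
   sum starts at [s = 1]. *)
Definition v2_sum (a : K) (n : nat) : int :=
  \sum_(s0 a <= s < n.+1) fine (v2rat (b_ a s)).

Definition p'_ (a : K) (n : nat) : rat := 2 ^ (- v2_sum a n) * p_ a n.
Definition q'_ (a : K) (n : nat) : rat := 2 ^ (- v2_sum a n) * q_ a n.

End Algorithm.

(* Main.v *)
(** Write [a n] for the complete quotients and [P n] for the product
    [a 1 * ... * a n].  The [a n] satisfy quadratic equations
    [A n * x ^ 2 + B n * x + A (n - 1) = 0] of constant discriminant over
    [Z[1/2]], and [A (n + 1) = A n / a (n + 1) ^ 2 - D / a (n + 1)] with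
    [D = +/- (2 * A 0 * a 0 + B 0)].  Since [|a n| > 1] (every other time
    [|a n| > 2]) and [|a n|_2 >= 1], the [A n] are bounded for both absolute
    values, so there are finitely many of them and the expansion is eventually
    periodic.

    Exactly, [q n * a (n + 1) + q (n - 1) = P (n + 1)] and
    [a 0 - p n / q n = (-1) ^ n / (q n * P (n + 1))].  Hence [r n = q n / P n]
    satisfies [r (n + 1) = 1 - r n / (a (n + 1) * a (n + 2))], is a 2-adic unit,
    and is bounded and bounded away from [0] in the reals.  The real and 2-adic
    errors are thus of order [|P n| ^ -2] and [|P n|_2 ^ -2], while [|q' n|] is
    of order [|P n| * |P n|_2].  By periodicity both logarithms of [P n] grow
    linearly up to bounded terms, and [gamma] is the share of the 2-adic one. *)
Require Import Defs.
From mathcomp Require Import all_boot all_order all_algebra all_field.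
From mathcomp Require Import all_classical all_reals all_analysis.
From mathcomp Require Import zify ring lra.

Set Implicit Arguments.
Unset Strict Implicit.
Unset Printing Implicit Defensive.

Import Order.TTheory GRing.Theory Num.Theory.
Local Open Scope ring_scope.

(** * The 2-adic valuation on [Q2] *)

Lemma to_Q2_surj (u : Q2) : exists x, u = to_Q2 x.
Proof. by exists (repr (u : {ideal_quot null2b})); rewrite to_Q2_repr. Qed.

Lemma v2_0 : v2 0 = +oo%E.
Proof. by have := v2_ratr 0; rewrite v2rat0 /ratr mul0r. Qed.

Lemma v2_stable (x : cauchySeq2) : to_Q2 x != 0 ->
  exists (N : nat) (v : int), v2 (to_Q2 x) = v%:E /\
    forall n, (N <= n)%N -> v2rat (x n) = v%:E.
Proof.
rewrite to_Q2_eq0 => nx.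
have [|N [v hv]] := cauchy2_stable (asboolW (valP x)).
  by move=> h; case/asboolP: nx.
by exists N, v; split => //; exact: v2_to_Q2 hv.
Qed.

Lemma v2_1 : v2 1 = 0%E.
Proof. by have := v2_ratr 1; rewrite /ratr divr1. Qed.

Lemma v2_fin (u : Q2) : u != 0 -> v2 u = (fine (v2 u))%:E.
Proof. by have [x ->] := to_Q2_surj u; move=> /v2_stable [N [k [-> _]]]. Qed.

Lemma v2M (u v : Q2) : v2 (u * v) = (v2 u + v2 v)%E.
Proof.
have v2NNy (w : Q2) : v2 w != -oo%E.
  have [->|/v2_fin -> //] := eqVneq w 0; first by rewrite v2_0.
have [->|] := eqVneq u 0; first by rewrite mul0r v2_0 addye.
have [->|] := eqVneq v 0; first by rewrite mulr0 v2_0 addey.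
have [x ->] := to_Q2_surj u; have [y ->] := to_Q2_surj v.
move=> /v2_stable [Ny [vy [-> hy]]] /v2_stable [Nx [vx [-> hx]]].
rewrite -rmorphM; apply: (@v2_to_Q2 _ _ (maxn Nx Ny)) => n.
rewrite geq_max => /andP[xn yn].
by rewrite -(hx n) // -(hy n) // -v2ratM.
Qed.

Lemma v2D (k : \bar int) (u v : Q2) :
  (k <= v2 u)%E -> (k <= v2 v)%E -> (k <= v2 (u + v)%R)%E.
Proof.
have [->|] := eqVneq u 0; first by rewrite add0r.
have [->|] := eqVneq v 0; first by rewrite addr0.
have [->|] := eqVneq (u + v) 0; first by rewrite v2_0 leey.
have [x ->] := to_Q2_surj u; have [y ->] := to_Q2_surj v; rewrite -rmorphD.
move=> /v2_stable [N [w [-> hw]]].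
move=> /v2_stable [Ny [vy [-> hy]]] /v2_stable [Nx [vx [-> hx]]].
pose n := maxn N (maxn Nx Ny).
rewrite -(hx n) ?leq_max ?leqnn ?orbT //.
rewrite -(hy n) ?leq_max ?leqnn ?orbT //.
rewrite -(hw n) ?leq_max ?leqnn ?orbT //.
exact: v2ratD.
Qed.

Lemma v2N (u : Q2) : v2 (- u) = v2 u.
Proof.
rewrite -mulN1r v2M (_ : v2 (-1) = 0%E) ?add0e //.
by have := v2_ratr (-1); rewrite /ratr divr1.
Qed.

Lemma v2_signM (n : nat) (u : Q2) : v2 ((-1) ^+ n * u) = v2 u.
Proof. by rewrite -signr_odd; case: odd; rewrite ?expr1 ?mulN1r ?mul1r ?v2N. Qed.

Lemma v2B (k : \bar int) (u v : Q2) :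
  (k <= v2 u)%E -> (k <= v2 v)%E -> (k <= v2 (u - v)%R)%E.
Proof. by move=> hu hv; apply: v2D; rewrite ?v2N. Qed.

Lemma v2V (u : Q2) : u != 0 -> v2 u^-1 = (- v2 u)%E.
Proof.
move=> u0; have := v2M u u^-1; rewrite divff // v2_1.
rewrite [v2 u]v2_fin // [v2 u^-1]v2_fin ?invr_eq0 // => -[e].
by congr (_%:E); lia.
Qed.

(** * Existence of 2-adic digits and the 2-adic floor *)

Lemma v2rat_exp2 (n : int) : v2rat (2 ^ n) = n%:E.
Proof.
have h (m : nat) : v2rat (2 ^+ m) = m%:Z%:E.
  rewrite -[2 ^+ m]divr1 -[2 ^+ m](_ : ((2 ^+ m : int)%:~R) = _); last first.
    by rewrite rmorphXn.
  rewrite (v2rat_frac (b := 1)) ?expf_neq0 // abszX /= lognX logn_prime //=.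
  by congr (_%:E); rewrite ?logn1; lia.
case: n => n; first exact: h.
by rewrite -[2 ^ _]/((2 ^+ n.+1)^-1) v2ratV ?expf_neq0 // h.
Qed.

(** [x / 2 ^ n] is a quotient of two odd integers, so subtracting 1 makes its numerator even. This
    is why digits 0 and 1 suffice. *)
Lemma v2rat_subr_exp2 (x : rat) (n : int) : v2rat x = n%:E ->
  ((n + 1)%:E <= v2rat (x - 2 ^ n)%R)%E.
Proof.
move=> xn; have p0 : (2 : rat) ^ n != 0 by rewrite expfz_neq0.
pose y := x / 2 ^ n.
have y_v : v2rat y = 0%:E.
  by rewrite v2ratM v2ratV // v2rat_exp2 xn -EFinN -EFinD subrr.
have -> : x - 2 ^ n = 2 ^ n * (y - 1) by rewrite /y; field.
apply: v2ratM_ge; first by rewrite v2rat_exp2.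
have [->|y1] := eqVneq y 1; first by rewrite subrr v2rat0 leey.
have y0 : y != 0 by apply: contra_eq_neq y_v => ->; rewrite v2rat0.
have b0 := denq_neq0 y; have a0 : numq y != 0 by rewrite numq_eq0.
have ab : numq y - denq y != 0.
  apply: contraNneq y1 => /eqP; rewrite subr_eq0 => /eqP e.
  by rewrite -[y]divq_num_den e divff ?intr_eq0.
have -> : y - 1 = (numq y - denq y)%:~R / (denq y)%:~R.
  by rewrite intrB mulrBl divff ?intr_eq0 // divq_num_den.
rewrite v2rat_frac // lee_fin.
move: y_v; rewrite /v2rat (negPf y0) => -[] e.
have := coprime_num_den y.
have lg (z : int) : z != 0 -> (0 < logn 2 `|z|)%N = (2 %| `|z|)%N.
  by move=> z0; rewrite logn_gt0 mem_primes /= absz_gt0 z0.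
have := lg _ a0; have := lg _ b0; have := lg _ ab.
move: e; set u := logn _ _; set v := logn _ _; set w := logn _ _.
rewrite /coprime => e hw hv hu cop.
have [v0|v0] := posnP v.
  suff : (0 < w)%N by lia.
  rewrite hw; lia.
have : (2 %| gcdn `|numq y| `|denq y|)%N by rewrite dvdn_gcd -hu -hv; lia.
by rewrite (eqP cop).
Qed.

Lemma ratr_Q2D (x y : rat) : ratr (x + y) = ratr x + ratr y :> Q2.
Proof.
by rewrite !ratr_Q2 -rmorphD; congr to_Q2; apply: val_inj; apply/funext.
Qed.

Lemma v2_subr_exp2 (u : Q2) (n : int) : v2 u = n%:E ->
  ((n + 1)%:E <= v2 (u - ratr (2 ^ n))%R)%E.
Proof.
have [x ->] := to_Q2_surj u; rewrite ratr_Q2 -rmorphB /=.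
pose d : cauchySeq2 := x - CauchySeq2 (const_cauchy2 (2 ^ n)).
rewrite -[to_Q2 (x - _)]/(to_Q2 d) => xn.
have [->|/v2_stable [N [w [-> hw]]]] := eqVneq (to_Q2 d) 0.
  by rewrite v2_0 leey.
have [|N' [v [vE hx]]] := @v2_stable x.
  by apply: contra_eq_neq xn => ->; rewrite v2_0.
rewrite -(hw (maxn N N')) ?leq_maxl //.
by apply: v2rat_subr_exp2; rewrite hx ?leq_maxr // -vE.
Qed.

(* What is left of [u] once its digits at the places [M, ..., M + k - 1] have
   been removed. *)
Fixpoint digit_rest (u : Q2) (M : int) (k : nat) : Q2 :=
  if k is k'.+1 then
    let r := digit_rest u M k' in
    if v2 r == (M + k'%:Z)%:E then r - ratr (2 ^ (M + k'%:Z)) else r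
  else u.

Lemma v2_digit_rest (u : Q2) (M : int) (k : nat) : (M%:E <= v2 u)%E ->
  ((M + k%:Z)%:E <= v2 (digit_rest u M k))%E.
Proof.
move=> Mu; elim: k => [|k IH] /=; first by rewrite addr0.
rewrite intS addrCA addrC; case: eqP => [/v2_subr_exp2 //|/eqP ne].
have : ((M + k%:Z)%:E < v2 (digit_rest u M k))%E by rewrite lt_neqAle eq_sym ne.
have [->|r0] := eqVneq (digit_rest u M k) 0; first by rewrite v2_0 leey.
by rewrite v2_fin // lte_fin lee_fin lezD1.
Qed.

Lemma digit_rest_id (u : Q2) (M : int) (k : nat) : ((M + k%:Z)%:E <= v2 u)%E ->
  digit_rest u M k = u.
Proof.
elim: k => // k IH h /=.
have {}h : ((M + k%:Z)%:E < v2 u)%E.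
  by apply: lt_le_trans h; rewrite lte_fin; lia.
by rewrite IH ?ltW // eq_sym lt_eqF.
Qed.

Lemma digit_rest_shift (u : Q2) (M : int) (d k : nat) :
  ((M + d%:Z)%:E <= v2 u)%E ->
  digit_rest u M (d + k) = digit_rest u (M + d%:Z) k.
Proof.
move=> h; elim: k => [|k IH]; first by rewrite addn0 digit_rest_id.
by rewrite addnS /= IH PoszD addrA.
Qed.

(** Starting below the valuation removes only zero digits, so only the end place matters. In
    [digits2_ex] the starting place varies with the digit. *)
Lemma digit_rest_indep (u : Q2) (M M' : int) (k k' : nat) :
  (M%:E <= v2 u)%E -> (M'%:E <= v2 u)%E -> M + k%:Z = M' + k'%:Z ->
  digit_rest u M k = digit_rest u M' k'.
Proof.
wlog le : M M' k k' / M <= M' => [hw hM hM' e|hM hM' e].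
  have [le|le] := leP M M'; first exact: hw.
  by apply/esym/hw => //; exact: ltW.
have eM : M' = M + (k - k')%N%:Z by lia.
by rewrite eM -digit_rest_shift -?eM // subnK //; lia.
Qed.

(** Greedy expansion: the digit at place [n] is 1 exactly when the remainder left by the lower
    places has valuation [n]. Existence ensures that [digits2] is not the default sequence. *)
Lemma digits2_ex (u : Q2) : exists c, is_digits2 u c.
Proof.
have [m hm] : exists m : int, (m%:E <= v2 u)%E.
  have [->|/v2_fin ->] := eqVneq u 0; first by exists 0; rewrite v2_0 leey.
  by exists (fine (v2 u)).
(* A start at most [n] and at most the valuation of [u], so that the number of places from it up to
   [n] is a natural number. *)
pose M (n : int) : int := Num.min m n.
have hM n : ((M n)%:E <= v2 u)%E.
  by apply: le_trans hm; rewrite lee_fin ge_min lexx.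
have eM n : M n + `|n - M n|%N%:Z = n by rewrite /M; lia.
exists (fun n => v2 (digit_rest u (M n) `|n - M n|) == n%:E); split.
  by move=> n nu; rewrite digit_rest_id ?eM ?ltW // eq_sym lt_eqF.
move=> M' hM' A; exists `|A - M'|%N => k hk.
pose c n := v2 (digit_rest u (M n) `|n - M n|) == n%:E.
suff -> : ratr (\sum_(i < k) (c (M' + i%:Z))%:R * 2 ^ (M' + i%:Z)) =
    u - digit_rest u M' k.
  rewrite subKr; apply: le_trans (v2_digit_rest k hM').
  by rewrite lee_fin; lia.
elim: k {hk} => [|k IH]; first by rewrite big_ord0 /ratr mul0r subrr.
rewrite big_ord_recr ratr_Q2D {}IH /c.
rewrite (digit_rest_indep (hM (M' + k%:Z)) hM' (eM (M' + k%:Z))) /=.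
case: ifP => _; last by rewrite mul0r /ratr mul0r addr0.
by rewrite mul1r opprB [X in _ = u + X]addrC addrA.
Qed.

Lemma digits2P (u : Q2) : is_digits2 u (digits2 u).
Proof. by have := digits2_ex u; apply: xgetPex. Qed.

Lemma v2rat_sum (k : \bar int) (n : nat) (F : 'I_n -> rat) :
  (forall i, (k <= v2rat (F i))%E) -> (k <= v2rat (\sum_i F i)%R)%E.
Proof.
move=> h; elim/big_ind: _ => [|x y|i _]; first by rewrite v2rat0 leey.
- exact: v2ratD.
- exact: h.
Qed.

(** The floor collects the digits at the places [- m] to 0; all later digits sit at places of
    valuation at least 1. *)
Lemma v2_sub_floor2 (u : Q2) : (1%:E <= v2 (u - ratr (floor2 u))%R)%E.
Proof.
have [_ hu] := digits2P u.
set m := `|fine (v2 u)|%N.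
have [|k0 hk0] := hu (- m%:Z) _ 1.
  have [->|/v2_fin ->] := eqVneq u 0; first by rewrite v2_0 leey.
  by rewrite lee_fin; lia.
have := hk0 (m.+1 + k0)%N (leq_addl _ _).
rewrite big_split_ord /= ratr_Q2D.
set S1 := \sum_(i < m.+1) _; set S2 := \sum_(i < k0) _ => h.
have -> : floor2 u = S1.
  (* [floor2] runs through the places downwards, the expansion upwards. *)
  rewrite /floor2 /S1 (reindex_inj rev_ord_inj) /=; apply: eq_bigr => i _.
  have -> : - (m.+1 - i.+1)%N%:Z = - m%:Z + i%:Z by have := ltn_ord i; lia.
  by [].
have -> : u - ratr S1 = u - (ratr S1 + ratr S2) + ratr S2.
  by rewrite opprD addrA subrK.
apply: v2D => //; rewrite v2_ratr; apply: v2rat_sum => i.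
case: digits2; last by rewrite mul0r v2rat0 leey.
by rewrite mul1r v2rat_exp2 lee_fin; lia.
Qed.

(** * The ring [Z[1/2]] *)

Definition dyadic (x : rat) : Prop := exists k : nat, x * 2 ^+ k \is a Num.int.

Lemma dyadic_int (x : rat) : x \is a Num.int -> dyadic x.
Proof. by exists 0%N; rewrite mulr1. Qed.

Lemma dyadicD (x y : rat) : dyadic x -> dyadic y -> dyadic (x + y).
Proof.
move=> [j hx] [k hy]; exists (j + k)%N.
rewrite (_ : _ * _ = x * 2 ^+ j * 2 ^+ k + y * 2 ^+ k * 2 ^+ j); last first.
  by rewrite exprD; ring.
by rewrite rpredD // rpredM // rpredX // natr_int.
Qed.

Lemma dyadicM (x y : rat) : dyadic x -> dyadic y -> dyadic (x * y).
Proof.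
move=> [j hx] [k hy]; exists (j + k)%N.
by rewrite exprD mulrACA rpredM.
Qed.

(** The denominator is a power of 2, and the valuation bounds its exponent. This turns a uniform
    2-adic bound into a common denominator. *)
Lemma dyadic_mul_exp2_int (x : rat) (k : nat) :
  dyadic x -> ((- k%:Z)%:E <= v2rat x)%E -> x * 2 ^+ k \is a Num.int.
Proof.
have p0 i : (2 : rat) ^+ i != 0 by rewrite expf_neq0.
move=> [j hj] hk; have [->|x0] := eqVneq x 0; first by rewrite mul0r rpred0.
have [jk|kj] := leqP j k.
  by rewrite -(subnKC jk) exprD mulrA rpredM // rpredX // natr_int.
move: hj => /intrP [z hz].
have z0 : z != 0.
  by apply: contraNneq x0 => z0; move/eqP: hz;
    rewrite z0 mulf_eq0 (negPf (p0 _)) orbF.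
have vz : v2rat (x * 2 ^+ j) = (logn 2 `|z|%N)%:Z%:E.
  rewrite hz -[z%:~R]divr1 (v2rat_frac (b := 1)) //.
  by congr (_%:E); rewrite logn1; lia.
have /dvdzP [w hw] : ((2 ^ (j - k))%N %| z)%Z.
  rewrite dvdzE /= pfactor_dvdn ?absz_gt0 //.
  move: vz hk; rewrite v2ratM exprnP v2rat_exp2 [v2rat x]v2ratN0 //.
  by rewrite lee_fin => -[]; lia.
apply/intrP; exists w; apply: (mulIf (p0 (j - k)%N)).
rewrite -mulrA -exprD subnKC ?(ltnW kj) // hz hw intrM; congr (_ * _).
by rewrite -natrX.
Qed.

Lemma dyadic_exp2 (n : int) : dyadic (2 ^ n).
Proof.
case: n => n; first by apply: dyadic_int; rewrite rpredX // natr_int.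
by exists n.+1; rewrite -[2 ^ _]/((2 ^+ n.+1)^-1) mulVf ?expf_neq0 // rpred1.
Qed.

Lemma dyadic_floor2 (u : Q2) : dyadic (floor2 u).
Proof.
rewrite /floor2; elim/big_ind: _ => [|x y|i _]; first exact: dyadic_int.
- exact: dyadicD.
- by apply: dyadicM; [apply: dyadic_int; rewrite natr_int|exact: dyadic_exp2].
Qed.

(** * Nearest lattice points and periodic sequences *)

(** [f] decreases up to [i0] and increases from [i0 + 1], so a least minimizer exists and
    [least_argmin] is not its default. Since [f i0 + f (i0 + 1) = c], the minimum is at most half of
    [c]. *)
Lemma least_argmin_dist (R : realType) (c y : R) (f : int -> R) : 0 < c ->
  (forall i, f i = `|y - c * i%:~R|) -> f (least_argmin f) <= c / 2.
Proof.
move=> c0 hf; pose i0 := Num.floor (y / c).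
have /andP[lo hi] := floor_itv (y / c).
rewrite -/i0 in lo hi.
have {}lo : c * i0%:~R <= y by move: lo; rewrite ler_pdivlMr // mulrC.
have {}hi : y < c * (i0 + 1)%:~R by move: hi; rewrite ltr_pdivrMr // mulrC.
have f0 : f i0 = y - c * i0%:~R by rewrite hf ger0_norm // subr_ge0.
have f1 : f (i0 + 1) = c * (i0 + 1)%:~R - y.
  by rewrite hf ler0_norm ?opprB // subr_le0 ltW.
have flt i : i < i0 -> f i0 < f i.
  move=> ii; rewrite f0 hf; apply: lt_le_trans (ler_norm _).
  by rewrite ltrD2l ltrN2 ltr_pM2l // ltr_int.
have fge i : i0 + 1 <= i -> f (i0 + 1) <= f i.
  move=> ii; rewrite f1 hf distrC; apply: le_trans (ler_norm _).
  by rewrite lerD2r ler_pM2l // ler_int.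
have [m [mE mmin]] : exists m : int, is_argmin f m /\
    forall i : int, is_argmin f i -> m <= i.
  have [le|lt] := leP (f i0) (f (i0 + 1)).
    exists i0; split=> i.
      have [/flt/ltW //|ii] := ltP i i0.
      have [-> //|ne] := eqVneq i i0.
      by apply: le_trans le (fge _ _); lia.
    by move=> /(_ i0) h; rewrite leNgt; apply/negP => /flt; rewrite ltNge h.
  exists (i0 + 1); split=> i.
    have [ii|ii] := ltP i (i0 + 1); last exact: fge.
    apply: le_trans (ltW lt) _.
    have [-> //|ne] := eqVneq i i0.
    by apply/ltW/flt; lia.
  move=> h; rewrite leNgt; apply/negP => ii.
  have := h (i0 + 1); apply/negP; rewrite -ltNge.
  have [-> //|ne] := eqVneq i i0.
  by apply: lt_trans lt (flt _ _); lia.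
have [hm _] : is_argmin f (least_argmin f) /\
    forall i : int, is_argmin f i -> least_argmin f <= i.
  by rewrite /least_argmin; case: xgetP => [? _ []|/(_ m) []].
have := hm i0; have := hm (i0 + 1); rewrite f0 f1 intrD mulrDr mulr1.
by lra.
Qed.

Lemma eventually_periodic_bounded (R : realDomainType) (f : nat -> R)
    (i L : nat) :
  (0 < L)%N -> (forall n, (i <= n)%N -> f (n + L)%N = f n) ->
  exists M, forall n, `|f n| <= M.
Proof.
move=> L0 per; exists (\sum_(k < i + L) `|f k|).
elim/ltn_ind => n IH; have [lt|le] := ltnP n (i + L).
  by rewrite (bigD1 (Ordinal lt)) //= lerDl sumr_ge0.
by rewrite -(subnK (_ : L <= n)%N) ?per ?IH; lia.
Qed.

(** With [F] and [G] the sums over one period, [gamma = G / (F + G)] solves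
    [gamma * F = (1 - gamma) * G]. The weighted difference then has no drift, so it is eventually
    periodic and hence bounded. The index [k] makes [G] positive. *)
Lemma periodic_balance (R : realFieldType) (f g : nat -> R) (i L k : nat) :
  (0 < L)%N -> (i <= k < i + L)%N ->
  (forall n, (i <= n)%N -> f (n + L)%N = f n) ->
  (forall n, (i <= n)%N -> g (n + L)%N = g n) ->
  (forall n, 0 < f n) -> (forall n, 0 <= g n) -> 0 < g k ->
  exists gamma H : R, [/\ 0 < gamma, gamma < 1 &
    forall n, `|gamma * (\sum_(0 <= j < n) f j)
                - (1 - gamma) * (\sum_(0 <= j < n) g j)| <= H].
Proof.
move=> L0 /andP[ik kL] fper gper f0 g0 gk.
pose F := \sum_(i <= j < i + L) f j; pose G := \sum_(i <= j < i + L) g j.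
have F0 : 0 < F.
  rewrite /F (big_ltn (m := i)) ?ltr_wpDr //; last by lia.
  by rewrite sumr_ge0 // => j _; exact: ltW.
have G0 : 0 < G.
  rewrite /G (@big_cat_nat _ _ _ k) //=; last by lia.
  rewrite [X in _ + X]big_ltn // addrCA ltr_wpDr // addr_ge0 ?sumr_ge0 //.
pose gamma := G / (F + G).
have FG0 : F + G != 0 by rewrite gt_eqF ?addr_gt0.
have gamma_lt1 : gamma < 1.
  by rewrite /gamma ltr_pdivrMr ?addr_gt0 // mul1r ltrDr.
have gamma_gt0 : 0 < gamma by rewrite divr_gt0 ?addr_gt0.
pose S n := gamma * (\sum_(0 <= j < n) f j)
           - (1 - gamma) * (\sum_(0 <= j < n) g j).
have SS n : S n.+1 = S n + (gamma * f n - (1 - gamma) * g n).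
  by rewrite /S !big_nat_recr //=; ring.
have SL n : (i <= n)%N -> S (n + L)%N = S n.
  move=> /subnK <-; elim: (n - i)%N => [|m IH].
    rewrite add0n /S !(@big_cat_nat _ _ _ i 0 (i + L)) ?leq_addr //=.
    by rewrite -/F -/G /gamma; field.
  by rewrite !addSn !SS IH fper ?gper ?leq_addl.
have [H hH] := eventually_periodic_bounded L0 SL.
by exists gamma, H.
Qed.

Lemma expR_ln2 (R : realType) (z : int) : (2 : R) ^ z = expR (z%:~R * ln 2).
Proof. by rewrite -powR_intmul // /powR pnatr_eq0. Qed.

(** Otherwise [u = (u + d) - d] would have valuation larger than its own. *)
Lemma v2D_lt (u d : Q2) : (v2 u < v2 d)%E -> v2 (u + d) = v2 u.
Proof.
move=> ud; have h : (v2 u <= v2 (u + d)%R)%E by rewrite v2D // ltW.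
apply/eqP; rewrite eq_le h andbT leNgt; apply/negP => lt.
have : (Order.min (v2 d) (v2 (u + d)%R) <= v2 u)%E.
  rewrite -{2}(addrK d u); apply: v2D; first by rewrite ge_min lexx orbT.
  by rewrite v2N ge_min lexx.
by rewrite leNgt lt_min ud lt.
Qed.

Lemma ratr_in_alg (L : fieldExtType rat) (r : rat) : ratr r = r%:A :> L.
Proof. by rewrite -(fmorph_eq_rat (in_alg L)). Qed.

(** * One step of the algorithm at an irrational element *)

Section Expansion.
Variables (R : realType) (K : fieldExtType rat).
Variables (soo : {rmorphism K -> R}) (s2 : {rmorphism K -> Q2}).

Local Notation irrational a := (a \notin (1%VS : {vspace K})).

Lemma soo_in_alg (r : rat) : soo r%:A = ratr r.
Proof. by rewrite -ratr_in_alg fmorph_rat. Qed.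

Lemma s2_in_alg (r : rat) : s2 r%:A = ratr r.
Proof. by rewrite -ratr_in_alg fmorph_rat. Qed.

Lemma in_alg_mem1 (r : rat) : r%:A \in (1%VS : {vspace K}).
Proof. by rewrite memvZ // mem1v. Qed.

Lemma mem1P (a : K) : reflect (exists r, a = r%:A) (a \in (1%VS : {vspace K})).
Proof. exact: vlineP. Qed.

Lemma irrational_neq (a : K) (r : rat) : irrational a -> a != r%:A.
Proof. by apply: contraNneq => ->; exact: in_alg_mem1. Qed.

Lemma irrational_neq0 (a : K) : irrational a -> a != 0.
Proof. by move=> /(irrational_neq 0); rewrite scale0r. Qed.

Lemma irrational_affine (a : K) (r s : rat) : r != 0 -> irrational a ->
  irrational (r%:A * a + s%:A).
Proof.
move=> r0; apply: contra => /mem1P [t h]; apply/mem1P; exists ((t - s) / r).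
have rA : r%:A != 0 :> K by rewrite scaler_eq0 oner_eq0 orbF.
apply: (mulfI rA); rewrite -[r%:A * a](addrK s%:A) h.
rewrite -[_%:A]/(in_alg K _) -[r%:A]/(in_alg K _) -[s%:A]/(in_alg K _).
rewrite -[((_ - _) / _)%:A]/(in_alg K _).
by rewrite -rmorphB -rmorphM mulrC divfK.
Qed.

Lemma irrational_inv (a : K) : irrational a -> irrational a^-1.
Proof.
apply: contra => /mem1P [t h]; apply/mem1P; exists t^-1.
by rewrite -[a]invrK h -[t^-1%:A]/(in_alg K _) fmorphV.
Qed.

(** [soo] is injective, so equality would make [a] rational. This makes the real size bounds
    strict. *)
Lemma irrational_soo_neq (a : K) (r : rat) :
  irrational a -> `|soo a| != `|ratr r|.
Proof.
move=> ia; rewrite -ratr_norm; apply/negP => /eqP.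
case: (ger0P (soo a)) => _ h.
  by case/negP: (irrational_neq `|r| ia);
    rewrite -(inj_eq (fmorph_inj soo)) soo_in_alg h.
case/negP: (irrational_neq (- `|r|) ia).
by rewrite -(inj_eq (fmorph_inj soo)) soo_in_alg rmorphN /= -h opprK.
Qed.

(** At 0 this is the default 0, whence the nonzero hypotheses below. *)
Definition val2 (a : K) : int := fine (v2 (s2 a)).

Lemma v2_s2 (a : K) : a != 0 -> v2 (s2 a) = (val2 a)%:E.
Proof. by move=> a0; rewrite /val2 -v2_fin // fmorph_eq0. Qed.

Lemma val2M (a b : K) : a != 0 -> b != 0 -> val2 (a * b) = val2 a + val2 b.
Proof.
move=> a0 b0; have : v2 (s2 (a * b)) = (val2 a + val2 b)%:E.
  by rewrite rmorphM v2M !v2_s2.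
by rewrite v2_s2 ?mulf_neq0 // => -[].
Qed.

Lemma val2V (a : K) : a != 0 -> val2 a^-1 = - val2 a.
Proof.
move=> a0; have : v2 (s2 a^-1) = (- val2 a)%:E.
  by rewrite fmorphV v2V ?fmorph_eq0 // v2_s2.
by rewrite v2_s2 ?invr_eq0 // => -[].
Qed.

Section Step.
Variables (eps : bool) (a : K).
Hypothesis a_irr : irrational a.
Local Notation b := (b_eps soo s2 eps a).

Lemma dyadic_b_eps : dyadic b.
Proof.
rewrite /b_eps; case: eps; apply: dyadicD (dyadic_floor2 _);
  apply: dyadic_int; rewrite ?rpredM ?natr_int ?intr_int //.
Qed.

Lemma sub_b_eps_irrational : irrational (a - b%:A).
Proof.
have := irrational_affine (- b) (oner_neq0 _) a_irr.
by rewrite scale1r mul1r scaleNr.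
Qed.

(** Half the spacing of the candidates for [b], which is 1 or 2. *)
Lemma soo_sub_b_eps : `|soo (a - b%:A)| <= if eps then 2^-1 else 1.
Proof.
rewrite rmorphB soo_in_alg /b_eps; case: eps; rewrite rmorphD /=.
  rewrite ratr_int opprD addrA.
  have := @least_argmin_dist R 1 (soo a - ratr (floor2 (s2 a)))
    (fun i => `|soo a - i%:~R - ratr (floor2 (s2 a))|) ltr01.
  by rewrite div1r; apply => i; rewrite mul1r addrAC.
rewrite rmorphM /= ratr_int ratr_nat opprD addrA.
have := @least_argmin_dist R 2 (soo a - ratr (floor2 (s2 a)))
  (fun i => `|soo a - 2 * i%:~R - ratr (floor2 (s2 a))|) (ltr0n _ 2).
by rewrite divff //; apply => i; rewrite addrAC.
Qed.

(** Removing the floor leaves valuation at least 1; an even integer preserves this, an arbitrary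
    integer only preserves the bound 0. *)
Lemma v2_sub_b_eps : ((if eps then 0 else 1)%:E <= v2 (s2 (a - b%:A)%R))%E.
Proof.
rewrite rmorphB s2_in_alg /b_eps.
set u := s2 a; have hu := v2_sub_floor2 u.
have int_ge0 (m : int) : (0%:E <= v2rat m%:~R)%E.
  have [->|m0] := eqVneq m 0; first by rewrite v2rat0 leey.
  by rewrite -[m%:~R]divr1 (v2rat_frac (b := 1)) // lee_fin logn1; lia.
case: eps.
  set m := least_argmin _; rewrite ratr_Q2D opprD addrCA addrC.
  apply: v2B; first by apply: le_trans hu; rewrite lee_fin.
  by rewrite v2_ratr int_ge0.
set m := least_argmin _; rewrite ratr_Q2D opprD addrCA addrC.
apply: v2B => //; rewrite v2_ratr -[1]addr0; apply: v2ratM_ge => //.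
Qed.

Lemma F2E : F2 soo s2 eps a = (a - b%:A)^-1.
Proof. by rewrite /F2 ratr_in_alg div1r. Qed.

Lemma F2_irrational : irrational (F2 soo s2 eps a).
Proof. by rewrite F2E irrational_inv // sub_b_eps_irrational. Qed.

Lemma soo_F2_gt : (if eps then 2 else 1) < `|soo (F2 soo s2 eps a)|.
Proof.
have e : `|ratr (if eps then 2 else 1)| = if eps then 2 else 1 :> R.
  by case: eps; rewrite (ratr_nat _ 2, ratr_nat _ 1) ger0_norm.
rewrite lt_neqAle -{1}e eq_sym irrational_soo_neq ?F2_irrational //=.
rewrite F2E fmorphV normfV.
have h0 : 0 < `|soo (a - b%:A)|.
  by rewrite normr_gt0 fmorph_eq0 irrational_neq0 // sub_b_eps_irrational.
have := soo_sub_b_eps; case: eps in h0 * => hle.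
  by rewrite -[2]invrK lef_pV2 // posrE invr_gt0.
by rewrite -[1]invr1 lef_pV2 ?posrE.
Qed.

Lemma val2_F2_le : val2 (F2 soo s2 eps a) <= if eps then 0 else -1.
Proof.
rewrite F2E val2V ?irrational_neq0 ?sub_b_eps_irrational //.
have := v2_sub_b_eps; rewrite v2_s2 ?irrational_neq0 ?sub_b_eps_irrational //.
by rewrite lee_fin; case: eps; lia.
Qed.

(** [a - b] has larger valuation than [a], so [b] inherits that of [a]. Thus [v2_sum] becomes the
    valuation of a product of complete quotients. *)
Lemma v2rat_b_eps : val2 a < (if eps then 0 else 1) -> v2rat b = (val2 a)%:E.
Proof.
move=> ha; rewrite -v2_ratr -s2_in_alg.
have -> : b%:A = a + - (a - b%:A) by rewrite opprB addrC subrK.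
rewrite rmorphD v2D_lt v2_s2 ?irrational_neq0 //.
rewrite rmorphN v2N; apply: lt_le_trans v2_sub_b_eps.
by rewrite lte_fin.
Qed.
End Step.

End Expansion.

(** * Pigeonhole principles and common denominators *)

Lemma nat_pigeonhole (T : finType) (g : nat -> T) :
  exists i j : nat, (i < j)%N /\ g i = g j.
Proof.
have : ~~ injectiveb (fun k : 'I_#|T|.+1 => g k).
  by apply/injectiveP => /leq_card; rewrite card_ord ltnn.
move=> /injectiveP /existsNP [i /existsNP [j /not_implyP [e ne]]].
have [lt|lt|eq] := ltngtP i j; first by exists i, j.
- by exists j, i.
- by case: ne; exact: val_inj.
Qed.

(** Parity is recorded because the step of the algorithm depends on it; the resulting period is
    even. *)
Lemma bounded_int_pigeonhole (N : nat) (z w : nat -> int) :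
  (forall n, `|z n| <= N%:Z) -> (forall n, `|w n| <= N%:Z) ->
  exists i j : nat, [/\ (i < j)%N, z i = z j, w i = w j & odd i = odd j].
Proof.
move=> hz hw.
pose c (x : int) : 'I_(N + N).+1 := inord `|(x + N%:Z)%R|%N.
have c_inj (x y : int) : `|x| <= N%:Z -> `|y| <= N%:Z -> c x = c y -> x = y.
  by move=> hx hy /(congr1 val); rewrite /= !inordK; lia.
have [i [j [ij [ez ew eo]]]] :=
  nat_pigeonhole (fun n => (c (z n), c (w n), odd n)).
by exists i, j; split => //; exact: c_inj.
Qed.

Lemma rat_common_denominator (a b c : rat) : exists2 d : rat, d != 0 &
  [/\ a * d \is a Num.int, b * d \is a Num.int & c * d \is a Num.int].
Proof.
exists (denq a * denq b * denq c)%:~R.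
  by rewrite intr_eq0 !mulf_neq0 ?denq_neq0.
have h (x : rat) (m n : int) : x * (denq x * m * n)%:~R \is a Num.int.
  by rewrite -mulrA intrM mulrA -numqE -intrM intr_int.
split; first exact: h.
- by rewrite [denq a * _]mulrC h.
- by rewrite [_ * denq c]mulrC mulrA h.
Qed.

(** * Quadratic forms along the orbit and periodicity *)

Section Orbit.
Variables (R : realType) (K : fieldExtType rat).
Variables (soo : {rmorphism K -> R}) (s2 : {rmorphism K -> Q2}).
Variable alpha : K.
Hypothesis alpha_irr : alpha \notin (1%VS : {vspace K}).

Local Notation a := (alpha_ soo s2 alpha).
Local Notation b := (b_ soo s2 alpha).

Lemma alphaS (n : nat) : a n.+1 = (a n - (b n)%:A)^-1.
Proof. exact: F2E. Qed.

Lemma alpha_irrational (n : nat) : a n \notin (1%VS : {vspace K}).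
Proof. by elim: n => // n IH; exact: F2_irrational. Qed.

Lemma alpha_neq0 (n : nat) : a n != 0.
Proof. exact/irrational_neq0/alpha_irrational. Qed.

Lemma soo_alpha_gt (n : nat) : (if odd n then 2 else 1) < `|soo (a n.+1)|.
Proof. by apply: soo_F2_gt; exact: alpha_irrational. Qed.

Lemma val2_alpha_le (n : nat) : val2 s2 (a n.+1) <= if odd n then 0 else -1.
Proof. by apply: val2_F2_le; exact: alpha_irrational. Qed.

(** The initial [alpha] obeys no valuation bound, hence the shift by one. *)
Lemma v2rat_b (n : nat) : v2rat (b n.+1) = (val2 s2 (a n.+1))%:E.
Proof.
apply: v2rat_b_eps; first exact: alpha_irrational.
by apply: le_lt_trans (val2_alpha_le n) _ => /=; case: (odd n).
Qed.

Lemma b_alpha (n : nat) : (b n)%:A = a n - (a n.+1)^-1.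
Proof. by rewrite alphaS invrK subKr. Qed.

Lemma in_algD (x y : rat) : (x + y)%:A = x%:A + y%:A :> K.
Proof. exact: scalerDl. Qed.

Lemma in_algM (x y : rat) : (x * y)%:A = x%:A * y%:A :> K.
Proof. exact: (rmorphM (in_alg K)). Qed.

(** In dimension 2 the elements 1, [alpha] and [alpha ^+ 2] are dependent; irrationality of [alpha]
    keeps the leading coefficient nonzero. *)
Lemma quadratic_eq : \dim {: K} = 2%N -> exists A B C : rat,
  [/\ A != 0, [/\ A \is a Num.int, B \is a Num.int & C \is a Num.int] &
   A%:A * alpha ^+ 2 + B%:A * alpha + C%:A = 0].
Proof.
move=> dimK.
have [A [B [C [A0 e]]]] : exists A B C : rat, A != 0 /\
    A%:A * alpha ^+ 2 + B%:A * alpha + C%:A = 0.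
  have : ~~ free [tuple 1; alpha; alpha ^+ 2].
    apply/negP; rewrite /free => /eqP h.
    by have := dimvS (subvf <<[tuple 1; alpha; alpha ^+ 2]>>); rewrite h dimK.
  move=> /freeP /existsNP [k /not_implyP [e /existsNP ne]].
  move: e; rewrite !big_ord_recl big_ord0 /= addr0.
  set k0 := k _; set k1 := k _; set k2 := k _ => e.
  have {}e : k2%:A * alpha ^+ 2 + k1%:A * alpha + k0%:A = 0.
    by rewrite !mulr_algl -[RHS]e addrC addrA addrAC -addrA addrC.
  have [k20|] := eqVneq k2 0; last by exists k2, k1, k0.
  have [k10|k10] := eqVneq k1 0; last first.
    have := irrational_neq0 (irrational_affine k0 k10 alpha_irr).
    by move: e; rewrite k20 scale0r mul0r add0r => ->; rewrite eqxx.
  have k00 : k0 = 0.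
    move/eqP: e; rewrite k20 k10 !scale0r !mul0r !add0r.
    by rewrite scaler_eq0 oner_eq0 orbF => /eqP.
  case: ne => -[[|[|[|//]]] hi]; case.
  - by rewrite -[RHS]k00; congr (k _); exact: val_inj.
  - by rewrite -[RHS]k10; congr (k _); exact: val_inj.
  - by rewrite -[RHS]k20; congr (k _); exact: val_inj.
have [d d0 [dA dB dC]] := rat_common_denominator A B C.
exists (A * d), (B * d), (C * d); split => //; first by rewrite mulf_neq0.
rewrite !in_algM -(mulr0 d%:A) -e; ring.
Qed.

(** The substitution [x = b k + 1 / y] in [A * x ^ 2 + B * x + C], cleared of the denominator
    [y ^ 2]. *)
Fixpoint quad (f : rat * rat * rat) (n : nat) : rat * rat * rat :=
  if n is k.+1 then
    let: (A, B, C) := quad f k in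
    (A * b k ^+ 2 + B * b k + C, 2 * A * b k + B, A)
  else f.

(** [(-1) ^+ n * delta] is the derivative of the [n]-th form at its root [a n], and [D] is the
    common discriminant. The recurrence for [A] is the Taylor expansion of that form at [a n],
    evaluated at [b n = a n - 1 / a n.+1]. *)
Lemma quadratic_forms : \dim {: K} = 2%N ->
  exists (A B : nat -> rat) (D : rat) (delta : K),
  [/\ forall n, dyadic (A n) /\ dyadic (B n), delta != 0,
      forall n, A n != 0,
      forall n, (2 * A n)%:A * a n + (B n)%:A = (-1) ^+ n * delta &
      forall n,
      [/\ (A n.+1)%:A = (A n)%:A / a n.+1 ^+ 2 - (-1) ^+ n * delta / a n.+1
        & B n.+1 ^+ 2 = D + 4 * A n.+1 * A n]].
Proof.
move=> /quadratic_eq [A0 [B0 [C0 [A00 [hA0 hB0 hC0] e0]]]].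
pose f := quad (A0, B0, C0).
pose A n := (f n).1.1; pose B n := (f n).1.2; pose C n := (f n).2.
have AS n : A n.+1 = A n * b n ^+ 2 + B n * b n + C n.
  by rewrite /A /B /C /f /=; case: quad => [[]].
have BS n : B n.+1 = 2 * A n * b n + B n.
  by rewrite /A /B /C /f /=; case: quad => [[]].
have CS n : C n.+1 = A n.
  by rewrite /A /B /C /f /=; case: quad => [[]].
have two : (2 : rat)%:A = 2 :> K by rewrite -[2%:A]/(in_alg K 2) rmorph_nat.
pose delta := (2 * A0)%:A * alpha + B0%:A.
pose D := B0 ^+ 2 - 4 * A0 * C0.
have AE n : (A n.+1)%:A
    = (A n)%:A * (b n)%:A ^+ 2 + (B n)%:A * (b n)%:A + (C n)%:A :> K.
  by rewrite AS !in_algD !in_algM expr2.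
have BE n : (B n.+1)%:A = 2 * (A n)%:A * (b n)%:A + (B n)%:A :> K.
  by rewrite BS !in_algD !in_algM two.
have eE n : (A n)%:A * a n ^+ 2 + (B n)%:A * a n + (C n)%:A = 0.
  (* The new form at [a n.+1] is [a n.+1 ^+ 2] times the old one at [a n]. *)
  elim: n => [//|n IH]; rewrite AE BE CS b_alpha -(mulr0 (a n.+1 ^+ 2)) -IH.
  by field; exact: alpha_neq0.
have dE n : 2 * (A n)%:A * a n + (B n)%:A = (-1) ^+ n * delta.
  elim: n => [|n IH]; first by rewrite mul1r /delta in_algM two.
  rewrite exprS mulN1r mulNr -IH AE BE b_alpha.
  (* The sign flip holds modulo [2 * a n.+1] times the equation of [a n]. *)
  rewrite -[RHS]addr0 -(mulr0 (2 * a n.+1)) -(eE n).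
  by field; exact: alpha_neq0.
have delta_irr : delta \notin (1%VS : {vspace K}).
  by apply: irrational_affine => //; rewrite mulf_neq0.
exists A, B, D, delta; split.
- suff h n : [/\ dyadic (A n), dyadic (B n) & dyadic (C n)].
    by move=> n; have [] := h n.
  elim: n => [|n [hA hB hC]]; first by split; exact: dyadic_int.
  have hb : dyadic (b n) by exact: dyadic_b_eps.
  have h2 : dyadic 2 by apply: dyadic_int; rewrite natr_int.
  rewrite AS BS CS; split=> //; rewrite ?expr2.
    by do !apply: dyadicD => //; do !apply: dyadicM.
  by apply: dyadicD => //; do !apply: dyadicM.
- exact: irrational_neq0.
- move=> n; apply: contraNneq delta_irr => An0; apply/mem1P.
  exists ((-1) ^+ n * B n); rewrite in_algM.
  have := dE n; rewrite An0 scale0r mulr0 mul0r add0r => ->.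
  by rewrite -[_%:A]/(in_alg K _) rmorph_sign signrMK.
- by move=> n; rewrite in_algM two.
- move=> n; split.
    rewrite -dE AE b_alpha.
    rewrite -[RHS]addr0 -(eE n).
    by field; exact: alpha_neq0.
  suff h m : B m ^+ 2 - 4 * A m * C m = D by rewrite -(h n.+1) CS; ring.
  by elim: m => [//|m <-]; rewrite AS BS CS; ring.
Qed.

(** The scaled values are integers, so [Num.floor] merely reads them as elements of [int] for the
    pigeonhole. *)
Lemma floor_scaled_bounded (A : nat -> rat) (k : nat) (M : R) :
  (forall n, A n * 2 ^+ k \is a Num.int) ->
  (forall n, `|ratr (A n)| <= M) ->
  exists N : nat, forall n, `|Num.floor (A n * 2 ^+ k)| <= N%:Z.
Proof.
move=> hint hM; exists (Num.bound (M * 2 ^+ k)) => n.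
have M0 : 0 <= M by apply: le_trans (hM n).
rewrite -(ler_int R) intr_norm -ratr_int floorK ?hint // rmorphM rmorphXn /=.
rewrite ratr_nat normrM normrX normr_nat.
apply: ltW; apply: le_lt_trans (archi_boundP _); last first.
  by rewrite mulr_ge0 ?exprn_ge0.
by rewrite ler_pM2r ?exprn_gt0.
Qed.

Lemma alpha_eventually_periodic : \dim {: K} = 2%N ->
  exists i L : nat, [/\ (0 < L)%N, ~~ odd L &
    forall n, (i <= n)%N -> a (n + L)%N = a n].
Proof.
move=> /quadratic_forms [A [B [D [delta [hdy delta0 A_neq0 dE hS]]]]].
have AS n := (hS n).1; have BS n := (hS n).2.
have soo0 n : soo (a n) != 0 by rewrite fmorph_eq0 alpha_neq0.
pose x n := `|ratr (A n) : R|; pose d := `|soo delta|.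
have d0 : 0 <= d by exact: normr_ge0.
have x0 n : 0 <= x n by exact: normr_ge0.
have xS n : x n.+1 <= x n * `|soo (a n.+1)|^-1 ^+ 2 + d * `|soo (a n.+1)|^-1.
  rewrite /x -[ratr (A n.+1)](soo_in_alg soo) AS.
  move: (a n.+1) => y; rewrite rmorphB /=.
  apply: le_trans (ler_normB _ _) _.
  rewrite !fmorph_div /= rmorphXn rmorphM /= rmorph_sign soo_in_alg.
  by rewrite !normrM !normfV normrX normr_sign mul1r exprVn.
(* The bound alternates: an even index costs at most one more [d], and after an odd index the
   factors 1/4 and 1/2 give [(x 0 + 2 * d) / 4 + d / 2 <= x 0 + d]. *)
have xM n : x n <= x 0 + d + (if odd n then d else 0).
  elim: n => [|n IH]; first by rewrite addr0 lerDl.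
  apply: le_trans (xS n) _.
  have y1 : `|soo (a n.+1)|^-1 <= if odd n then 2^-1 else 1.
    rewrite invf_ple ?posrE ?normr_gt0 //; last by case: (odd n).
    have := ltW (soo_alpha_gt n).
    by case: (odd n); rewrite ?invrK ?invr1.
  have y0 : 0 <= `|soo (a n.+1)|^-1 by rewrite invr_ge0.
  have := x0 0; have := x0 n; move: y1 y0 IH.
  move: (_^-1) => y /=; case: (odd n) => /= y1 y0 IH xn0 x00.
    have : x n * y ^+ 2 <= x n * (2^-1) ^+ 2.
      by apply: ler_wpM2l => //; rewrite lerXn2r // nnegrE.
    have : d * y <= d * 2^-1 by apply: ler_wpM2l.
    by lra.
  have : x n * y ^+ 2 <= x n * 1 ^+ 2.
    by apply: ler_wpM2l => //; rewrite lerXn2r // nnegrE.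
  have : d * y <= d * 1 by apply: ler_wpM2l.
  by lra.
pose M := x 0 + d + d.
have {}xM n : `|ratr (A n)| <= M.
  by apply: le_trans (xM n) _; rewrite /M lerD2l; case: odd.
(* The square is bounded through the discriminant; the added 1 serves [u <= u ^ 2 + 1]. *)
have BM n : `|ratr (B n.+1)| <= `|ratr D| + 4 * M * M + 1 :> R.
  have h : `|ratr (B n.+1)| ^+ 2 <= `|ratr D| + 4 * M * M :> R.
    rewrite -normrX -rmorphXn BS rmorphD !rmorphM /= ratr_nat.
    apply: le_trans (ler_normD _ _) _; rewrite lerD2l normrM [`|4 * _|]normrM.
    rewrite (ger0_norm (ler0n _ _)) -!mulrA ler_pM2l //.
    by apply: ler_pM.
  have := normr_ge0 (ratr (B n.+1) : R); move: h.
  by set u := `|_|; nra.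
(* Inverses of complete quotients have nonnegative valuation, so the recurrence never goes below the
   valuations of [A 0] and [delta]. *)
have vA : exists k : int, forall n, (k%:E <= v2rat (A n))%E.
  exists (Num.min (fine (v2rat (A 0%N))) (val2 s2 delta)).
  elim=> [|n IH].
    by rewrite [X in (_ <= X)%E]v2ratN0 // lee_fin ge_min lexx.
  have vi : (0%:E <= v2 (s2 (a n.+1)^-1%R))%E.
    rewrite v2_s2 ?invr_eq0 ?alpha_neq0 // val2V ?alpha_neq0 // lee_fin.
    by have := val2_alpha_le n; case: odd; lia.
  rewrite -[v2rat (A n.+1)]v2_ratr -(s2_in_alg s2) AS.
  move: (a n.+1) vi => y vi.
  rewrite rmorphB; apply: v2B.
    rewrite -exprVn expr2 !rmorphM /= !v2M s2_in_alg v2_ratr.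
    by rewrite -[X in (X <= _)%E]adde0 leeD // -[X in (X <= _)%E]adde0 leeD.
  rewrite rmorphM v2M /= -[X in (X <= _)%E]adde0 leeD //.
  rewrite rmorphM /= rmorph_sign v2_signM.
  by rewrite v2_s2 // lee_fin ge_min lexx orbT.
have [k hk] := vA.
(* Large enough for both [A] and [B]: the discriminant gives valuation at least [- 2 * e] for the
   square of [B]. *)
pose e := (`|k| + `|fine (v2rat D)|)%N.
have eA n : ((- e%:Z)%:E <= v2rat (A n))%E.
  by apply: le_trans (hk n); rewrite lee_fin /e; lia.
have eB n : ((- e%:Z)%:E <= v2rat (B n.+1))%E.
  have [->|B0] := eqVneq (B n.+1) 0; first by rewrite v2rat0 leey.
  have : ((- e%:Z + - e%:Z)%:E <= v2rat (B n.+1 ^+ 2)%R)%E.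
    rewrite BS; apply: v2ratD.
      have [->|D0] := eqVneq D 0; first by rewrite v2rat0 leey.
      by rewrite v2ratN0 // lee_fin /e; lia.
    apply: v2ratM_ge (eA n); rewrite -[- _]add0r; apply: v2ratM_ge (eA _).
    by [].
  by rewrite expr2 v2ratM v2ratN0 // !lee_fin; lia.
have hA n : A n.+1 * 2 ^+ e \is a Num.int.
  by apply: dyadic_mul_exp2_int; [have [] := hdy n.+1|exact: eA].
have hB n : B n.+1 * 2 ^+ e \is a Num.int.
  by apply: dyadic_mul_exp2_int; [have [] := hdy n.+1|exact: eB].
have [NA hNA] := floor_scaled_bounded hA (fun n => xM n.+1).
have [NB hNB] := floor_scaled_bounded hB BM.
have [||i [j [ij eqA eqB eqo]]] := @bounded_int_pigeonhole (NA + NB)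
    (fun n => Num.floor (A n.+1 * 2 ^+ e)) (fun n => Num.floor (B n.+1 * 2 ^+ e)).
- by move=> n; apply: le_trans (hNA n) _; lia.
- by move=> n; apply: le_trans (hNB n) _; lia.
have p0 : (2 : rat) ^+ e != 0 by rewrite expf_neq0.
have {}eqA : A i.+1 = A j.+1.
  by apply: (mulIf p0); rewrite -(floorK (hA i)) eqA floorK ?hA.
have {}eqB : B i.+1 = B j.+1.
  by apply: (mulIf p0); rewrite -(floorK (hB i)) eqB floorK ?hB.
(* [A], [B] and the parity of the index determine the complete quotient through the linear relation
   [dE]. *)
have eqa : a i.+1 = a j.+1.
  have A0 : (2 * A i.+1)%:A != 0 :> K.
    by rewrite scaler_eq0 oner_eq0 orbF mulf_neq0.
  apply: (mulfI A0); apply: (addIr (B i.+1)%:A).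
  by rewrite dE eqA eqB dE -signr_odd /= eqo -[in RHS]signr_odd.
exists i.+1, (j - i)%N; split=> //; first by rewrite subn_gt0.
  by rewrite oddB ?(ltnW ij) // eqo addbb.
(* An even shift keeps the rule chosen at each step, so a single coincidence propagates. *)
move=> n /subnK <-; elim: (n - i.+1)%N => [|m IH].
  by rewrite add0n eqa; congr a; lia.
rewrite addSn /= /F2 /b_eps IH; congr (1 / (_ - ratr (if _ then _ else _))).
by rewrite oddD oddB ?(ltnW ij) // eqo addbb addbF.
Qed.

(** * Convergents and the product of the complete quotients *)

Local Notation p := (p_ soo s2 alpha).
Local Notation q := (q_ soo s2 alpha).

Definition alpha_prod (n : nat) : K := \prod_(1 <= i < n.+1) a i.
Local Notation P := alpha_prod.

Lemma alpha_prod0 : P 0 = 1.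
Proof. by rewrite /P big_geq. Qed.

Lemma alpha_prodS (n : nat) : P n.+1 = P n * a n.+1.
Proof. by rewrite /P big_nat_recr. Qed.

Lemma alpha_prod_neq0 (n : nat) : P n != 0.
Proof.
elim: n => [|n IH]; first by rewrite alpha_prod0 oner_eq0.
by rewrite alpha_prodS mulf_neq0 ?alpha_neq0.
Qed.

Local Notation M := (conv_mx soo s2 alpha).

(** The second column holds [p] and [q] at the previous index; the matrix form covers the index
    -1. *)
Lemma conv_mxS (n : nat) :
  [/\ p n.+1 = p n * b n.+1 + M n 0 1, M n.+1 0 1 = p n,
      q n.+1 = q n * b n.+1 + M n 1 1 & M n.+1 1 1 = q n].
Proof.
rewrite /p_ /q_ [M n.+1]/conv_mx big_nat_recr //= -/(M n).
by split; rewrite !mxE !big_ord_recl big_ord0 !mxE /= ?mulr1 ?mulr0 ?addr0 //;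
  do ?congr (_ + _); congr (M n _ _); exact: val_inj.
Qed.

Lemma conv_mx0 : [/\ p 0 = b 0, M 0 0 1 = 1, q 0 = 1 & M 0 1 1 = 0].
Proof. by rewrite /p_ /q_ /conv_mx big_nat1; split; rewrite !mxE. Qed.

Lemma conv_alpha (n : nat) :
  (p n)%:A * a n.+1 + (M n 0 1)%:A = alpha * P n.+1 /\
  (q n)%:A * a n.+1 + (M n 1 1)%:A = P n.+1.
Proof.
elim: n => [|n [IHp IHq]].
  have [-> -> -> ->] := conv_mx0; rewrite alpha_prodS alpha_prod0 b_alpha.
  rewrite [a 0](_ : _ = alpha) //.
  rewrite !scale1r scale0r; move: (a 1) (alpha_neq0 1) => y y0.
  by split; field.
have [-> -> -> ->] := conv_mxS n; rewrite alpha_prodS mulrA -IHp -IHq.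
rewrite !in_algD !in_algM b_alpha.
by split; field; exact: alpha_neq0.
Qed.

(** Each factor of the matrix product has determinant -1. *)
Lemma conv_det (n : nat) : p n * M n 1 1 - M n 0 1 * q n = (-1) ^+ n.+1.
Proof.
elim: n => [|n IH].
  by have [-> -> -> ->] := conv_mx0; rewrite mulr0 mul1r sub0r expr1.
have [-> -> -> ->] := conv_mxS n; rewrite exprS -IH; ring.
Qed.

Lemma q_alpha_prod (n : nat) : (q n.+1)%:A * a n.+2 + (q n)%:A = P n.+2.
Proof. by have [_ _ _ <-] := conv_mxS n; have [_ ->] := conv_alpha n.+1. Qed.

(** The two relations of [conv_alpha] eliminate the second column from the determinant identity. *)
Lemma conv_error (n : nat) : q n != 0 ->
  alpha - (p n / q n)%:A = (-1) ^+ n / ((q n)%:A * P n.+1).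
Proof.
move=> q0; have qA : (q n)%:A != 0 :> K by rewrite scaler_eq0 oner_eq0 orbF.
have P0 := alpha_prod_neq0 n.+1.
have -> : (p n / q n)%:A = (p n)%:A / (q n)%:A :> K.
  by rewrite in_algM -[_^-1%:A]/(in_alg K _) fmorphV.
have [hp hq] := conv_alpha n.
have : (p n)%:A * (M n 1 1)%:A - (M n 0 1)%:A * (q n)%:A = (-1) ^+ n.+1 :> K.
  by rewrite -!in_algM -[LHS](rmorphB (in_alg K)) conv_det rmorph_sign.
rewrite exprS mulN1r => /(congr1 -%R); rewrite opprK => <-.
apply: (mulIf (mulf_neq0 qA P0)); rewrite divfK ?mulf_neq0 //.
have -> : (M n 1 1)%:A = P n.+1 - (q n)%:A * a n.+1 by rewrite -hq addrC addKr.
have -> : (M n 0 1)%:A = alpha * P n.+1 - (p n)%:A * a n.+1.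
  by rewrite -hp addrC addKr.
by field.
Qed.

Definition q_ratio (n : nat) : K := (q n)%:A / P n.
Local Notation r := q_ratio.

Lemma q_ratio0 : r 0 = 1.
Proof. by have [_ _ q0 _] := conv_mx0; rewrite /r q0 alpha_prod0 divr1 scale1r. Qed.

(** This is [q_alpha_prod] divided by [P n.+2]. *)
Lemma q_ratioS (n : nat) : r n.+1 = 1 - r n / (a n.+1 * a n.+2).
Proof.
have := q_alpha_prod n; rewrite !alpha_prodS /r alpha_prodS.
move: (a n.+1) (a n.+2) (alpha_neq0 n.+1) (alpha_neq0 n.+2) => x y x0 y0 e.
have P0 := alpha_prod_neq0 n; apply: (mulIf (mulf_neq0 (mulf_neq0 P0 x0) y0)).
have -> : (q n.+1)%:A = (P n * x * y - (q n)%:A) / y by rewrite -e addrK mulfK.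
by field; rewrite x0 y0.
Qed.

(** One of two consecutive steps has an even index and contributes at most -1. *)
Lemma val2_alpha_pair_lt (n : nat) : val2 s2 (a n.+1 * a n.+2) < 0.
Proof.
rewrite val2M ?alpha_neq0 //.
have := val2_alpha_le n; have := val2_alpha_le n.+1.
by rewrite [odd n.+1]/=; case: (odd n) => /=; lia.
Qed.

(** The recurrence subtracts from 1 an element of positive valuation. Nonvanishing is part of the
    induction and yields [q n != 0]. *)
Lemma val2_q_ratio (n : nat) : r n != 0 /\ val2 s2 (r n) = 0.
Proof.
elim: n => [|n [r0 vr]].
  by rewrite q_ratio0 oner_eq0 /val2 rmorph1 v2_1.
have aa0 : a n.+1 * a n.+2 != 0 by rewrite mulf_neq0 ?alpha_neq0.
have ra0 : r n / (a n.+1 * a n.+2) != 0 by rewrite mulf_neq0 // invr_eq0.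
have h : (v2 1%R < v2 (- s2 (r n / (a n.+1 * a n.+2)))%R)%E.
  rewrite v2N v2_1 (v2_s2 s2 ra0) val2M ?invr_eq0 // val2V // vr.
  by rewrite lte_fin; have := val2_alpha_pair_lt n; lia.
have e : v2 (s2 (r n.+1)) = 0%E by rewrite q_ratioS rmorphB rmorph1 (v2D_lt h) v2_1.
split; last by rewrite /val2 e.
by apply: contra_eq_neq e => ->; rewrite rmorph0 v2_0.
Qed.

Lemma q_neq0 (n : nat) : q n != 0.
Proof.
have [+ _] := val2_q_ratio n; apply: contraNneq => q0.
by rewrite /r q0 scale0r mul0r.
Qed.

Lemma q_ratioE (n : nat) : (q n)%:A = r n * P n.
Proof. by rewrite /r divfK ?alpha_prod_neq0. Qed.

Lemma soo_alpha_pair_gt (n : nat) : 2 < `|soo (a n.+1 * a n.+2)|.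
Proof.
rewrite rmorphM normrM.
have := soo_alpha_gt n; have := soo_alpha_gt n.+1.
rewrite [odd n.+1]/=; case: (odd n) => /= h1 h2.
  by rewrite -[2]mulr1; apply: ltr_pM.
by rewrite -[2]mul1r; apply: ltr_pM.
Qed.

(** The upper bound reproduces itself: divided by [2 + d] it becomes [1 / (1 + d)], and the two
    bounds are 1 minus and plus this quantity. *)
Lemma q_ratio_bounds (d : R) : 0 < d ->
  (forall n, 2 + d <= `|soo (a n.+1 * a n.+2)|) ->
  forall n, d / (1 + d) <= `|soo (r n)| <= (2 + d) / (1 + d).
Proof.
move=> d0 hd; have d1 : 0 < 1 + d by rewrite addr_gt0.
elim=> [|n /andP[_ IH]].
  rewrite q_ratio0 rmorph1 normr1 ler_pdivrMr // ler_pdivlMr // mul1r.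
  by rewrite lerDr ler01 lerD2r ler1n.
have h : `|soo (r n / (a n.+1 * a n.+2))| <= (1 + d)^-1.
  rewrite fmorph_div normrM normfV ler_pdivrMr; last first.
    by apply: lt_trans (soo_alpha_pair_gt n).
  apply: le_trans IH _; rewrite mulrC ler_pM2l ?invr_gt0 //; exact: hd.
rewrite q_ratioS rmorphB rmorph1; apply/andP; split.
  apply: le_trans (lerB_dist _ _); rewrite normr1.
  have -> : d / (1 + d) = 1 - (1 + d)^-1 by field; rewrite gt_eqF.
  by rewrite lerD2l lerN2.
apply: le_trans (ler_normB _ _) _; rewrite normr1.
have -> : (2 + d) / (1 + d) = 1 + (1 + d)^-1 by field; rewrite gt_eqF.
by rewrite lerD2l.
Qed.

(** The term at index 0 absorbs the case distinction in [s0]. *)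
Lemma v2_sumE (n : nat) :
  v2_sum soo s2 alpha n = v2_sum soo s2 alpha 0 + val2 s2 (P n).
Proof.
elim: n => [|n IH].
  by rewrite alpha_prod0 /val2 rmorph1 v2_1 addr0.
rewrite /v2_sum big_nat_recr /=; last by rewrite /s0; case: ifP.
rewrite -/(v2_sum soo s2 alpha n) IH v2rat_b /= alpha_prodS.
by rewrite val2M ?alpha_prod_neq0 ?alpha_neq0 // addrA.
Qed.

Lemma ln_alpha_prod (n : nat) :
  ln `|soo (P n)| = \sum_(0 <= j < n) ln `|soo (a j.+1)|.
Proof.
elim: n => [|n IH]; first by rewrite alpha_prod0 rmorph1 normr1 ln1 big_geq.
rewrite alpha_prodS rmorphM normrM lnM; first by rewrite IH big_nat_recr.
- by rewrite posrE normr_gt0 fmorph_eq0 alpha_prod_neq0.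
- by rewrite posrE normr_gt0 fmorph_eq0 alpha_neq0.
Qed.

Lemma val2_alpha_prod (n : nat) :
  - (val2 s2 (P n))%:~R * ln 2
    = \sum_(0 <= j < n) - (val2 s2 (a j.+1))%:~R * ln 2 :> R.
Proof.
elim: n => [|n IH].
  by rewrite alpha_prod0 big_geq // /val2 rmorph1 v2_1 oppr0 mul0r.
rewrite big_nat_recr //= -IH alpha_prodS val2M ?alpha_prod_neq0 ?alpha_neq0 //.
by rewrite intrD opprD mulrDl.
Qed.

End Orbit.

(** * The exponent and the two error estimates *)

Theorem corollary3p25 (R : realType) (K : fieldExtType rat)
    (quadratic_K : \dim {: K} = 2%N)
    (soo : {rmorphism K -> R}) (s2 : {rmorphism K -> Q2})
    (alpha : K) (alpha_irrational : alpha \notin (1%VS : {vspace K})) :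
  let p' := p'_ soo s2 alpha in
  let q' := q'_ soo s2 alpha in
  exists gamma C C' : R,
    [/\ 0 < gamma, gamma < 1, 0 < C, 0 < C' &
     forall n : nat, (0 < n)%N ->
       `|soo alpha - ratr (p' n / q' n)|
         <= C / `|ratr (q' n)| `^ (2 - 2 * gamma) /\
       abs2 R (s2 alpha - ratr (p' n / q' n))
         <= C' / `|ratr (q' n)| `^ (2 * gamma)].
Proof.
move=> p' q'.
have [i [L [L0 L_even per]]] :=
  alpha_eventually_periodic soo s2 alpha_irrational quadratic_K.
set a := alpha_ soo s2 alpha in per.
have a_neq0 n : a n != 0 := alpha_neq0 soo s2 alpha_irrational n.
have a_gt n := soo_alpha_gt soo s2 alpha_irrational n.
have a_val n := val2_alpha_le soo s2 alpha_irrational n.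
have ln2 : 0 < ln (2 : R) by rewrite ln_gt0 // ltr1n.
pose f n : R := ln `|soo (a n.+1)|.
pose g n : R := - (val2 s2 (a n.+1))%:~R * ln 2.
have perS n : (i <= n)%N -> a (n + L).+1 = a n.+1.
  by move=> le; rewrite -addSn per // leqW.
have [gamma [H [gamma0 gamma1 hH]]] : exists gamma H : R, [/\ 0 < gamma, gamma < 1 &
    forall n, `|gamma * (\sum_(0 <= j < n) f j)
                - (1 - gamma) * (\sum_(0 <= j < n) g j)| <= H].
  (* [i + odd i] is an even index, where [g] is positive; it lies in the period because [L] is even
     and positive, hence at least 2. *)
  apply: (@periodic_balance _ f g i L (i + odd i)) => //.
  - rewrite leq_addr ltn_add2l; case: (odd i) => //.
    by case: L L0 L_even {per perS} => [|[]].
  - by move=> n /perS e; rewrite /f e.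
  - by move=> n /perS e; rewrite /g e.
  - move=> n; apply: ln_gt0; apply: le_lt_trans (a_gt n).
    by case: (odd n); rewrite ?ler1n.
  - move=> n; apply: mulr_ge0; last exact: ltW.
    rewrite oppr_ge0 lerz0.
    by have := a_val n; case: (odd n); rewrite /a; lia.
  - apply: mulr_gt0 => //; rewrite oppr_gt0 ltrz0.
    by have := a_val (i + odd i)%N; rewrite oddD oddb addbb /a; lia.
(* A uniform gap above 2: the inverses of the individual gaps are eventually periodic, hence
   bounded. *)
have [d [d0 hd]] : exists d : R, 0 < d /\
    forall n, 2 + d <= `|soo (a n.+1 * a n.+2)|.
  have pgt n := soo_alpha_pair_gt soo s2 alpha_irrational n.
  have [|M hM] := @eventually_periodic_bounded R
      (fun n => (`|soo (a n.+1 * a n.+2)| - 2)^-1) i L L0.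
    by move=> n le; rewrite -addSn !perS // leqW.
  have pgt0 n : 0 < `|soo (a n.+1 * a n.+2)| - 2 by rewrite subr_gt0 pgt.
  have M0 : 0 < M.
    by apply: lt_le_trans (hM 0%N); rewrite normr_gt0 invr_eq0 gt_eqF.
  exists M^-1; rewrite invr_gt0; split=> // n.
  rewrite addrC -lerBrDr -[X in _ <= X]invrK lef_pV2 ?posrE ?invr_gt0 //.
  exact: le_trans (ler_norm _) (hM n).
have rE n := q_ratio_bounds alpha_irrational d0 hd n.
set r := q_ratio soo s2 alpha in rE.
pose A n : R := ln `|soo (alpha_prod soo s2 alpha n)|.
pose B n : R := - (val2 s2 (alpha_prod soo s2 alpha n))%:~R * ln 2.
pose kappa : R := - (v2_sum soo s2 alpha 0)%:~R * ln 2.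
pose rho n : R := ln `|soo (r n)|.
have {}hH n : `|gamma * A n - (1 - gamma) * B n| <= H.
  by rewrite /A /B ln_alpha_prod // val2_alpha_prod // hH.
have [rho0 hrho] : exists rho0, forall n, `|rho n| <= rho0.
  exists (`|ln (d / (1 + d))| + `|ln ((2 + d) / (1 + d))|) => n.
  have [lo hi] := andP (rE n).
  have c0 : 0 < d / (1 + d) by rewrite divr_gt0 ?addr_gt0.
  have r0 : 0 < `|soo (r n)| by exact: lt_le_trans lo.
  have lo' : ln (d / (1 + d)) <= rho n by rewrite ler_ln ?posrE.
  have hi' : rho n <= ln ((2 + d) / (1 + d)).
    by rewrite ler_ln ?posrE ?(lt_le_trans r0).
  rewrite ler_norml; apply/andP; split.
    apply: le_trans lo'; rewrite lerNl; apply: le_trans (ler_norm _) _.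
    by rewrite normrN lerDl.
  by apply: le_trans hi' _; apply: le_trans (ler_norm _) _; rewrite lerDr.
have q0 n : q_ soo s2 alpha n != 0 := q_neq0 soo s2 alpha_irrational n.
have P0 n : alpha_prod soo s2 alpha n != 0 :=
  alpha_prod_neq0 soo s2 alpha_irrational n.
have PE n : `|soo (alpha_prod soo s2 alpha n)| = expR (A n).
  by rewrite /A lnK // posrE normr_gt0 fmorph_eq0 P0.
have qE n : `|ratr (q_ soo s2 alpha n)| = expR (rho n + A n).
  rewrite -(soo_in_alg soo) q_ratioE // rmorphM normrM PE expRD /rho lnK //.
  have [r0 _] := val2_q_ratio soo s2 alpha_irrational n.
  by rewrite posrE normr_gt0 fmorph_eq0.
have q'E n : `|ratr (q' n)| = expR (kappa + B n + (rho n + A n)).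
  rewrite /q' /q'_ rmorphM normrM qE [in RHS]expRD; congr (_ * _).
  rewrite fmorphXz /= ratr_nat ger0_norm ?exprz_ge0 // expR_ln2 v2_sumE //.
  by congr expR; rewrite /kappa /B intrN intrD; ring.
have pq n : p' n / q' n = p_ soo s2 alpha n / q_ soo s2 alpha n.
  by rewrite /p' /q' /p'_ /q'_ -mulf_div divff ?mul1r // expfz_neq0.
(* Monotonicity lets [P n] replace [P n.+1] in the error terms. *)
have AS n : A n <= A n.+1.
  rewrite /A !ln_alpha_prod // big_nat_recr //= lerDl ln_ge0 //.
  by apply: ltW; apply: le_lt_trans (a_gt n); case: (odd n); rewrite ?ler1n.
have BS n : B n <= B n.+1.
  rewrite /B !val2_alpha_prod // big_nat_recr // lerDl.
  apply: mulr_ge0; last exact: ltW.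
  by rewrite oppr_ge0 lerz0; have := a_val n; case: (odd n); rewrite /a; lia.
have err_real n :
    `|soo alpha - ratr (p' n / q' n)| <= expR (- (rho n + A n + A n)).
  rewrite pq -(soo_in_alg soo) -rmorphB conv_error ?q0 //.
  rewrite fmorph_div rmorph_sign rmorphM normrM normfV normr_sign mul1r.
  rewrite normrM soo_in_alg qE PE -expRD -expRN ler_expR.
  by rewrite lerN2 lerD2l.
have err_2 n : abs2 R (s2 alpha - ratr (p' n / q' n)) <= expR (- (B n + B n)).
  rewrite pq -(s2_in_alg s2) -rmorphB conv_error ?q0 //.
  rewrite fmorph_div rmorph_sign /abs2 v2_signM -fmorphV.
  have qA0 : (q_ soo s2 alpha n)%:A != 0 :> K by rewrite scaler_eq0 oner_eq0 orbF.
  have [r0 vr] := val2_q_ratio soo s2 alpha_irrational n.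
  rewrite v2_s2 ?invr_eq0 ?mulf_neq0 ?P0 // val2V ?mulf_neq0 ?P0 //.
  rewrite val2M ?P0 // q_ratioE //.
  rewrite val2M ?P0 // vr expR_ln2 ler_expR opprK intrD intrD mulrDl.
  by have := BS n; rewrite /B; lra.
(* After taking logarithms, the real estimate reads [2 * ((1 - gamma) * B n - gamma * A n) + 2 * (1
   - gamma) * kappa + (1 - 2 * gamma) * rho n <= ln C]. The 2-adic one has the opposite first term,
   followed by [2 * gamma * (kappa + rho n)]. *)
exists gamma, (expR (2 * H + 2 * `|kappa| + rho0)),
  (expR (2 * H + 2 * `|kappa| + 2 * rho0)).
split; rewrite ?expR_gt0 // => n _; rewrite q'E -!expRM -!expRN -!expRD.
have := hH n; rewrite ler_norml => /andP[h1 h2].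
have := hrho n; rewrite ler_norml => /andP[r1 r2].
have : - `|kappa| <= kappa <= `|kappa| by rewrite -ler_norml.
move=> /andP[k1 k2]; split.
  apply: le_trans (err_real n) _; rewrite ler_expR.
  nra.
apply: le_trans (err_2 n) _; rewrite ler_expR.
nra.
Qed.
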